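(* The Sokolov system, i.e. the Hamiltonian system on $e(3)$ with Hamiltonian $$\hat H=M_1^2+M_2^2+2M_3^2+2c_1\gamma_1+2c_2(\gamma_2M_3-\gamma_3M_2)$$ ($c_1,c_2$ constants) and Lie–Poisson brackets $$\{M_i,M_j\}=\epsilon_{ijk}M_k,\quad \{M_i,\gamma_j\}=\epsilon_{ijk}\gamma_k,\quad \{\gamma_i,\gamma_j\}=0,$$ is a system of the Kowalevski type. It can be explicitly integrated in the theta-functions of genus 2.
   Context: $\epsilon_{ijk}$ is the totally skew-symmetric tensor. Discriminantly separable polynomial: a polynomial $\mathcal F(x_1,x_2,s)=A(x_1,x_2)s^2+B(x_1,x_2)s+C(x_1,x_2)$ of degree two in each of the three variables such that, for some one-variable polynomials $P,J$, $$B^2-4AC=4P(x_1)P(x_2),\quad \mathcal D_{x_1}(\mathcal F)(s,x_2)=4P(x_2)J(s),\quad \mathcal D_{x_2}(\mathcal F)(s,x_1)=4P(x_1)J(s),$$ where $\mathcal D_u(\mathcal F)$ is the discriminant of $\mathcal F$ as a quadratic polynomial in $u$. System of the Kowalevski type: a system of differential equations which, after some transformations (changes of variables, and constant rescaling of time), has variables $x_1,x_2,e_1,e_2$ and two further variables (denoted $r,\gamma_3$) such that, for some discriminantly separable polynomial $\mathcal F(x_1,x_2,s)=A(x_1,x_2)s^2+B(x_1,x_2)s+C(x_1,x_2)$ with one-variable polynomials $P,J$ satisfying $B^2-4AC=4P(x_1)P(x_2)$, $\mathcal D_{x_1}(\mathcal F)(s,x_2)=4P(x_2)J(s)$, $\mathcal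 D_{x_2}(\mathcal F)(s,x_1)=4P(x_1)J(s)$ (whose coefficients may depend on the values of constants of motion), $$2\dot x_1=-if_1,\quad \dot e_1=-me_1,\quad 2\dot x_2=if_2,\quad \dot e_2=me_2,$$ with $m$ a function of the system's variables, $$f_1^2=P(x_1)+e_1A(x_1,x_2),\qquad f_2^2=P(x_2)+e_2A(x_1,x_2),$$ and such that the first integrals and invariant relations reduce to $$P(x_2)e_1+P(x_1)e_2=C(x_1,x_2)-e_1e_2A(x_1,x_2).$$ ''Explicitly integrated in theta-functions of genus 2'' means that the integration reduces to the inversion of the Abel map of a hyperelliptic curve of genus (generically) two: with $s_1,s_2$ the roots of $\mathcal F(x_1,x_2,s)=0$ in $s$, one has $\frac{ds_1}{\sqrt{\Phi(s_1)}}+\frac{ds_2}{\sqrt{\Phi(s_2)}}=0$ and $\frac{s_1ds_1}{\sqrt{\Phi(s_1)}}+\frac{s_2ds_2}{\sqrt{\Phi(s_2)}}=c\,dt$ with $c$ a nonzero constant, $\Phi$ a polynomial proportional to $J(s)(s-k)(s+k)$, and $e_1e_2=k^2$ constant. For the Sokolov system the role of $x_1,x_2,e_1,e_2$ is played by $z_1=M_1+iM_2$, $z_2=M_1-iM_2$, $$e_1=z_1^2-2c_1(\gamma_1+i\gamma_2)-c_2^2a-c_2\big(2\gamma_2M_3-2\gamma_3M_2+2i(\gamma_3M_1-\gamma_1M_3)\big),$$ $$e_2=z_2^2-2c_1(\gamma_1-i\gamma_2)-c_2^2a-c_2\big(2\gamma_2M_3-2\gamma_3M_2+2i(\gamma_1M_3-\gamma_3M_1)\big),$$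 where $a=\gamma_1^2+\gamma_2^2+\gamma_3^2$ is a Casimir function. *)

(* Defs.v *)
From HB Require Import structures.
From mathcomp Require Import all_boot all_order all_algebra all_field.
From mathcomp Require Import all_real_closed.
From mathcomp Require Import all_classical all_reals all_analysis.
Set Implicit Arguments.
Unset Strict Implicit.
Unset Printing Implicit Defensive.
Import Order.TTheory GRing.Theory Num.Theory.
Import numFieldNormedType.Exports.
Local Open Scope classical_set_scope.
Local Open Scope complex_scope.
Local Open Scope ring_scope.

Section ComplexCalculus.
Variable R : realType.

(* [R[i]] carries no normed [R]-module structure in the library, so
   derivatives of complex-valued functions of real arguments are taken on real
   and imaginary parts. *)
Definition is_cderive (f : R -> R[i]) (t : R) (l : R[i]) : Prop :=
  is_derive t (1 : R) (fun u : R => complex.Re (f u) : R) (complex.Re l) /\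
  is_derive t (1 : R) (fun u : R => complex.Im (f u) : R) (complex.Im l).

Definition ccontinuous_at (f : R -> R[i]) (t : R) : Prop :=
  {for t, continuous (fun u : R => complex.Re (f u) : R)} /\
  {for t, continuous (fun u : R => complex.Im (f u) : R)}.

Definition cdifferentiable_at (V : normedModType R) (g : V -> R[i]) (p : V)
    : Prop :=
  differentiable (fun q => complex.Re (g q) : R) p /\
  differentiable (fun q => complex.Im (g q) : R) p.

Definition cdirderiv (V : normedModType R) (g : V -> R[i]) (p v : V) : R[i] :=
  'D_v (fun q => complex.Re (g q) : R) p +i*
  'D_v (fun q => complex.Im (g q) : R) p.

End ComplexCalculus.

Section DiscriminantlySeparable.
Variable K : fieldType.

(* The polynomial [\sum_(i, j, k < 3) F i j k x1^i x2^j s^k]. *)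
Definition triquadratic : Type := 'I_3 -> 'I_3 -> 'I_3 -> K.

Definition coef_s (F : triquadratic) (k : 'I_3) (x1 x2 : K) : K :=
  \sum_(i < 3) \sum_(j < 3) F i j k * x1 ^+ i * x2 ^+ j.

Definition coef_x1 (F : triquadratic) (i : 'I_3) (s x2 : K) : K :=
  \sum_(j < 3) \sum_(k < 3) F i j k * x2 ^+ j * s ^+ k.

Definition coef_x2 (F : triquadratic) (j : 'I_3) (s x1 : K) : K :=
  \sum_(i < 3) \sum_(k < 3) F i j k * x1 ^+ i * s ^+ k.

Definition polA (F : triquadratic) : K -> K -> K := coef_s F 2.
Definition polB (F : triquadratic) : K -> K -> K := coef_s F 1.
Definition polC (F : triquadratic) : K -> K -> K := coef_s F 0.

Definition eval3 (F : triquadratic) (x1 x2 s : K) : K :=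
  polA F x1 x2 * s ^+ 2 + polB F x1 x2 * s + polC F x1 x2.

Definition discr (q : 'I_3 -> K) : K := q 1 ^+ 2 - 4 * q 2 * q 0.

Definition degree_two_in_each (F : triquadratic) : Prop :=
  [/\ exists j k, F 2 j k != 0,
      exists i k, F i 2 k != 0 &
      exists i j, F i j 2 != 0].

(* The identities between polynomials are stated as identities between
   polynomial functions, [K] being infinite in the sequel. *)
Definition discriminantly_separable (F : triquadratic) (P J : {poly K})
    : Prop :=
  [/\ degree_two_in_each F,
      forall x1 x2, discr (fun k => coef_s F k x1 x2) = 4 * P.[x1] * P.[x2],
      forall s x2, discr (fun i => coef_x1 F i s x2) = 4 * P.[x2] * J.[s] &
      forall s x1, discr (fun j => coef_x2 F j s x1) = 4 * P.[x1] * J.[s]].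

End DiscriminantlySeparable.

Section PhaseSpace.
Variable R : realType.
Local Notation C := R[i].

(* The pair (M, gamma). *)
Definition phase : Type := ('rV[R]_3 * 'rV[R]_3)%type.

Definition Mc (i : 'I_3) (p : phase) : R := p.1 0 i.
Definition gc (i : 'I_3) (p : phase) : R := p.2 0 i.

Definition eM (i : 'I_3) : phase := (delta_mx 0 i, 0).
Definition eg (i : 'I_3) : phase := (0, delta_mx 0 i).

(* Addition in ['I_3] is modulo 3. *)
Definition epsilon (i j k : 'I_3) : R :=
  if (j == i + 1) && (k == i + 2) then 1
  else if (k == i + 1) && (j == i + 2) then -1 else 0.

(* The Poisson bracket determined by
   {M_i, M_j} = eps_ijk M_k, {M_i, g_j} = eps_ijk g_k, {g_i, g_j} = 0. *)
Definition poisson (f h : phase -> R) (p : phase) : R :=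
  \sum_(i < 3) \sum_(j < 3) \sum_(k < 3) epsilon i j k *
    ('D_(eM i) f p * 'D_(eM j) h p * Mc k p
     + ('D_(eM i) f p * 'D_(eg j) h p - 'D_(eg j) f p * 'D_(eM i) h p)
       * gc k p).

(* Sign convention: the time derivative of f is {f, H}. *)
Definition hamiltonian_field (H : phase -> R) (p : phase) : phase :=
  (\row_i poisson (Mc i) H p, \row_i poisson (gc i) H p).

Definition solution (V : phase -> phase) (D : set R) (p : R -> phase) : Prop :=
  [/\ open D, is_interval D &
      forall t, D t -> is_derive t (1 : R) p (V (p t))].

Definition first_integral (V : phase -> phase) (g : phase -> C) : Prop :=
  (forall p, cdifferentiable_at g p) /\
  forall D p, solution V D p ->
    forall t u, D t -> D u -> g (p t) = g (p u).

Definition function_of_constants (V : phase -> phase) (T : Type)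
    (G : phase -> T) : Prop :=
  exists (n : nat) (I : 'I_n -> phase -> C) (G0 : ('I_n -> C) -> T),
    (forall j, first_integral V (I j)) /\
    forall p, G p = G0 (fun j => I j p).

(* [x1, x2, e1, e2, r, g3] are coordinates near [p]: their complex Jacobian
   matrix with respect to (M, gamma) is invertible. *)
Definition coordinates_at (x1 x2 e1 e2 : phase -> C) (r g3 : phase -> R)
    (p : phase) : Prop :=
  let y := [tuple x1; x2; e1; e2; (fun q => (r q)%:C); (fun q => (g3 q)%:C)] in
  let b (j : 'I_(3 + 3)) :=
    match fintype.split j with inl k => eM k | inr k => eg k end in
  (forall i : 'I_(3 + 3), cdifferentiable_at (tnth y i) p) /\
  (\matrix_(i < 3 + 3, j < 3 + 3) cdirderiv (tnth y i) p (b j)) \in unitmx.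

Definition generically (Q : phase -> Prop) : Prop :=
  exists U : set phase, [/\ open U, dense U & forall p, U p -> Q p].

(* The equations of a system of the Kowalevski type, in the variables
   [x1, x2, e1, e2]. The rescaled time tau is given by dt = kappa dtau, so that
   d/dtau = kappa d/dt. The coefficients of [F], [P], [J] may depend on the
   values of constants of motion. *)
Definition kowalevski_equations (V : phase -> phase)
    (x1 x2 e1 e2 : phase -> C)
    (F : phase -> triquadratic C) (P J : phase -> {poly C}) : Prop :=
  [/\ [/\ function_of_constants V F, function_of_constants V P &
          function_of_constants V J],
      forall p, discriminantly_separable (F p) (P p) (J p),
      exists (kappa : R) (m f1 f2 : phase -> C),
        [/\ kappa != 0,
            forall D p, solution V D p -> forall t, D t ->
              exists dx1 dx2 de1 de2 : C,
                [/\ is_cderive (x1 \o p) t dx1 /\ is_cderive (x2 \o p) t dx2,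
                    is_cderive (e1 \o p) t de1 /\ is_cderive (e2 \o p) t de2,
                    2 * (kappa%:C * dx1) = - 'i%C * f1 (p t) /\
                    2 * (kappa%:C * dx2) = 'i%C * f2 (p t),
                    kappa%:C * de1 = - m (p t) * e1 (p t) &
                    kappa%:C * de2 = m (p t) * e2 (p t)],
            forall p, f1 p ^+ 2 =
              (P p).[x1 p] + e1 p * polA (F p) (x1 p) (x2 p) &
            forall p, f2 p ^+ 2 =
              (P p).[x2 p] + e2 p * polA (F p) (x1 p) (x2 p)] &
      forall p, (P p).[x2 p] * e1 p + (P p).[x1 p] * e2 p =
        polC (F p) (x1 p) (x2 p) - e1 p * e2 p * polA (F p) (x1 p) (x2 p)].

(* A polynomial proportional to J(s) (s - k) (s + k). *)
Definition curve_poly (lambda : C) (J : {poly C}) (k : C) : {poly C} :=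
  lambda *: (J * ('X - k%:P) * ('X + k%:P)).

(* [w1], [w2] are the branches of the square roots of Phi(s1), Phi(s2) carried
   along the motion. The equations make sense, and are required, on time
   intervals where F(x1, x2, s) has two distinct roots [s1 t], [s2 t] that are
   not ramification points of the curve. *)
Definition abel_equations (V : phase -> phase)
    (x1 x2 e1 e2 : phase -> C)
    (F : phase -> triquadratic C) (J : phase -> {poly C})
    (lambda c : C) : Prop :=
  [/\ lambda != 0, c != 0, first_integral V (fun p => e1 p * e2 p) &
    forall (D : set R) (p : R -> phase) (k : C) (s1 s2 : R -> C),
      solution V D p ->
      let Phi t := curve_poly lambda (J (p t)) k in
      (forall t, D t ->
        [/\ k ^+ 2 = e1 (p t) * e2 (p t),
            polA (F (p t)) (x1 (p t)) (x2 (p t)) != 0,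
            forall s, eval3 (F (p t)) (x1 (p t)) (x2 (p t)) s =
              polA (F (p t)) (x1 (p t)) (x2 (p t)) * (s - s1 t) * (s - s2 t),
            ccontinuous_at s1 t /\ ccontinuous_at s2 t &
            [/\ s1 t != s2 t, (Phi t).[s1 t] != 0 & (Phi t).[s2 t] != 0]]) ->
      exists ds1 ds2 w1 w2 : R -> C, forall t, D t ->
        [/\ is_cderive s1 t (ds1 t) /\ is_cderive s2 t (ds2 t),
            ccontinuous_at w1 t /\ ccontinuous_at w2 t,
            w1 t ^+ 2 = (Phi t).[s1 t] /\ w2 t ^+ 2 = (Phi t).[s2 t],
            ds1 t / w1 t + ds2 t / w2 t = 0 &
            s1 t * ds1 t / w1 t + s2 t * ds2 t / w2 t = c]].

(* The curve y^2 = Phi(s) has genus two: Phi is square-free of degree 5 or 6. *)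
Definition genus_two (Phi : {poly C}) : Prop :=
  ((size Phi == 6%N) || (size Phi == 7%N)) /\ separable_poly Phi.

End PhaseSpace.

Section Sokolov.
Variables (R : realType) (c1 c2 : R).
Local Notation C := R[i].
Local Notation M1 := (Mc 0).
Local Notation M2 := (Mc 1).
Local Notation M3 := (Mc 2).
Local Notation g1 := (gc 0).
Local Notation g2 := (gc 1).
Local Notation g3 := (gc 2).

Definition sokolov_hamiltonian (p : phase R) : R :=
  M1 p ^+ 2 + M2 p ^+ 2 + 2 * M3 p ^+ 2 + 2 * c1 * g1 p
  + 2 * c2 * (g2 p * M3 p - g3 p * M2 p).

Definition sokolov_field : phase R -> phase R :=
  hamiltonian_field sokolov_hamiltonian.

Definition casimir_a (p : phase R) : R :=
  g1 p ^+ 2 + g2 p ^+ 2 + g3 p ^+ 2.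

Definition sokolov_z1 (p : phase R) : C := M1 p +i* M2 p.
Definition sokolov_z2 (p : phase R) : C := M1 p -i* M2 p.

Definition sokolov_e1 (p : phase R) : C :=
  sokolov_z1 p ^+ 2 - 2 * c1%:C * (g1 p +i* g2 p)
  - c2%:C ^+ 2 * (casimir_a p)%:C
  - c2%:C * ((2 * g2 p * M3 p - 2 * g3 p * M2 p)
             +i* (2 * (g3 p * M1 p - g1 p * M3 p))).

Definition sokolov_e2 (p : phase R) : C :=
  sokolov_z2 p ^+ 2 - 2 * c1%:C * (g1 p -i* g2 p)
  - c2%:C ^+ 2 * (casimir_a p)%:C
  - c2%:C * ((2 * g2 p * M3 p - 2 * g3 p * M2 p)
             +i* (2 * (g1 p * M3 p - g3 p * M1 p))).

End Sokolov.

(* Main.v *)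
(* Along the flow, z1' = - i f1 / (2 kappa) and z2' = i f2 / (2 kappa) with
   f1^2 = P(z1) + e1 (z1 - z2)^2, f2^2 = P(z2) + e2 (z1 - z2)^2 and, which is
   the decisive identity, f1 f2 = B(z1, z2) / 2.  Here kappa = 1/2 and F is the
   Kowalevski polynomial with parameters
     h = H,  b = - 4 c1 (M.g),
     n = 4 c1^2 a - e1 e2 + 2 c2^2 (H a - 2 (M.g)^2) + c2^4 a^2
   and with s shifted by d = - c2^2 a.  On the surface F = 0 the partial
   derivatives satisfy (F_x)^2 = 4 P(y) J(s) and F_x F_y = 2 J(s) F_s, so that
   implicit differentiation of F(z1, z2, s1) = 0 gives
     ((s1 - s2) s1')^2 = - 4 J(s1) (s1^2 - e1 e2),
   and the same for s2: these are the Abel equations.  The roots s1 and s2 are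
   differentiable because s1 - s2 is a continuous square root of a nonvanishing
   differentiable function.
   The generic statements hold because a polynomial function on the phase space
   that is nonzero at one point is nonzero on a dense open set. *)
From HB Require Import structures.
Require Import Defs.
From mathcomp Require Import all_boot all_order all_algebra separable.
From mathcomp Require Import all_real_closed.
From mathcomp Require Import all_classical all_reals all_analysis.
From mathcomp Require Import ring lra.
Import Order.TTheory GRing.Theory Num.Theory.
Import numFieldNormedType.Exports.
Local Open Scope classical_set_scope.
Local Open Scope complex_scope.
Local Open Scope ring_scope.
Set Implicit Arguments.
Unset Strict Implicit.
Unset Printing Implicit Defensive.

(** * The Kowalevski polynomial *)

Section KowalevskiPolynomial.
Variable K : fieldType.
Variables h b n d : K.

(** The quartic of the Kowalevski top, with [n] in the place of its last constant term. *)
Definition kowP : {poly K} :=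
  - 'X^4 + (2 * h) *: 'X^2 + (2 * b) *: 'X + n%:P.

(** In the shifted variable [Y = s + d] this is the cubic [2 (h - Y) (Y^2 + n) - b^2], free of
    [d]. *)
Definition kowJ : {poly K} :=
  2 *: (((h - d)%:P - 'X) * (('X + d%:P) ^+ 2 + n%:P)) - (b ^+ 2)%:P.

(** The symmetric biquadratic form whose restriction to [x = y] is [kowP]. *)
Definition polar (x y : K) : K :=
  - (x ^+ 2 * y ^+ 2) + 2 * h * x * y + b * (x + y) + n.

(** The coefficient table of [(x - y)^2 Y^2 + 2 polar Y + kow_gap] with [Y = s + d]. The outer lists
    are indexed by the powers of [x] and [y], the innermost by those of [s]. *)
Definition kowF : triquadratic K := fun i j k =>
  nth 0 (nth [::] (nth [::]
    [:: [:: [:: b ^+ 2 - 2 * h * n + 2 * d * n; 2 * n; 0];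
            [:: 2 * b * d; 2 * b; 0];
            [:: n + d ^+ 2; 2 * d; 1]];
        [:: [:: 2 * b * d; 2 * b; 0];
            [:: 2 * n + 4 * h * d - 2 * d ^+ 2; 4 * h - 4 * d; - 2];
            [:: 2 * b; 0; 0]];
        [:: [:: n + d ^+ 2; 2 * d; 1];
            [:: 2 * b; 0; 0];
            [:: 2 * h - 2 * d; - 2; 0]]] i) j) k.

Lemma kowPE x : kowP.[x] = - x ^+ 4 + 2 * h * x ^+ 2 + 2 * b * x + n.
Proof. by rewrite !hornerE. Qed.

Lemma kowJE s : kowJ.[s] = 2 * (h - d - s) * ((s + d) ^+ 2 + n) - b ^+ 2.
Proof. by rewrite !hornerE /=; ring. Qed.

Lemma kowAE x y : polA kowF x y = (x - y) ^+ 2.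
Proof.
by rewrite /polA /coef_s !big_ord_recr !big_ord0 /kowF /=; ring.
Qed.

Lemma kowBE x y : polB kowF x y = 2 * (polar x y + d * (x - y) ^+ 2).
Proof.
by rewrite /polB /coef_s !big_ord_recr !big_ord0 /kowF /polar /=; ring.
Qed.

(* polar x y ^+ 2 - P(x) P(y) = (x - y) ^+ 2 * kow_gap x y. *)
Definition kow_gap (x y : K) : K :=
  2 * h * x ^+ 2 * y ^+ 2 + 2 * b * x * y * (x + y) + n * (x + y) ^+ 2
  - 2 * h * n + b ^+ 2.

Lemma kowCE x y : polC kowF x y =
  kow_gap x y + 2 * d * polar x y + d ^+ 2 * (x - y) ^+ 2.
Proof.
by rewrite /polC /coef_s !big_ord_recr !big_ord0 /kowF /polar /kow_gap /=; ring.
Qed.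

Lemma kow_discr_s x y : discr (fun k => coef_s kowF k x y) = 4 * kowP.[x] * kowP.[y].
Proof.
rewrite /discr -/(polA _) -/(polB _) -/(polC _) kowAE kowBE kowCE !kowPE /polar /kow_gap.
by ring.
Qed.

Lemma kow_sym i j k : kowF i j k = kowF j i k.
Proof.
by case: i => [[|[|[|[]]]] ?]; case: j => [[|[|[|[]]]] ?].
Qed.

Lemma kow_coef_x2 j s x : coef_x2 kowF j s x = coef_x1 kowF j s x.
Proof.
by apply: eq_bigr => i _; apply: eq_bigr => k _; rewrite kow_sym.
Qed.

Lemma kow_discr_x1 s y : discr (fun i => coef_x1 kowF i s y) = 4 * kowP.[y] * kowJ.[s].
Proof.
rewrite /discr /coef_x1 !big_ord_recr !big_ord0 kowPE kowJE /kowF /=.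
by ring.
Qed.

Lemma kow_discriminantly_separable : discriminantly_separable kowF kowP kowJ.
Proof.
split.
- by split; [exists 0, 2| exists 0, 2| exists 0, 2]; rewrite /kowF /= oner_eq0.
- exact: kow_discr_s.
- exact: kow_discr_x1.
- move=> s x; rewrite -kow_discr_x1 /discr.
  by rewrite !kow_coef_x2.
Qed.

(* The partial derivatives of F in x and in s; F being symmetric, the one in y
   is kow_dx y x s. *)
Definition kow_dx (x y s : K) : K :=
  2 * (x - y) * (s + d) ^+ 2
  + 2 * (s + d) * (- (2 * x * y ^+ 2) + 2 * h * y + b)
  + (4 * h * x * y ^+ 2 + 2 * b * (2 * x * y + y ^+ 2) + 2 * n * (x + y)).

Definition kow_ds (x y s : K) : K :=
  2 * (x - y) ^+ 2 * s + 2 * (polar x y + d * (x - y) ^+ 2).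

(** The polarised form of [kow_dx_sqr]. Keeping the explicit multiple of F makes it an identity
    valid off the surface F = 0 as well. *)
Lemma kow_dxdy x y s : kow_dx x y s * kow_dx y x s =
  2 * kowJ.[s] * kow_ds x y s
  + 4 * ((s + d - x * y) ^+ 2 + polar x y) * eval3 kowF x y s.
Proof.
rewrite /eval3 kowAE kowBE kowCE kowJE /kow_dx /kow_ds /polar /kow_gap.
by ring.
Qed.

(** A quadratic [q] with leading coefficient [l] satisfies [q'^2 = disc q + 4 l q]. Here [q] is F as
    a polynomial in [x]: its leading coefficient is [(s + d - y^2)^2 + P(y)] and its discriminant is
    [4 P(y) J(s)]. *)
Lemma kow_dx_sqr x y s : kow_dx x y s ^+ 2 =
  4 * kowP.[y] * kowJ.[s]
  + 4 * ((s + d - y ^+ 2) ^+ 2 + kowP.[y]) * eval3 kowF x y s.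
Proof.
rewrite /eval3 kowAE kowBE kowCE kowJE !kowPE /kow_dx /polar /kow_gap.
by ring.
Qed.

Lemma eval3_sym x y s : eval3 kowF x y s = eval3 kowF y x s.
Proof. by rewrite /eval3 !kowAE !kowBE !kowCE /polar /kow_gap; ring. Qed.

(** Up to a factor [i], the quantity being squared is the time derivative of F(x, y, s) at fixed
    [s]. After expansion, [F_x^2], [F_y^2] and [F_x F_y] all carry the factor J(s). The discriminant
    identity cancels the terms in [B^2], the relation between [e1] and [e2] brings in [k^2], and F =
    0 replaces [- (B s + C)] by [A s^2]. *)
Lemma kow_abel x y e1 e2 f1 f2 k s :
  f1 ^+ 2 = kowP.[x] + e1 * (x - y) ^+ 2 ->
  f2 ^+ 2 = kowP.[y] + e2 * (x - y) ^+ 2 ->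
  f1 * f2 = polar x y + d * (x - y) ^+ 2 ->
  k ^+ 2 = e1 * e2 ->
  kowP.[y] * e1 + kowP.[x] * e2 =
    polC kowF x y - e1 * e2 * polA kowF x y ->
  eval3 kowF x y s = 0 ->
  (kow_dx x y s * f1 - kow_dx y x s * f2) ^+ 2 =
  4 * (x - y) ^+ 4 * kowJ.[s] * ((s - k) * (s + k)).
Proof.
move=> f1E f2E f12 kE rel F0.
have dxy := kow_dxdy x y s; rewrite F0 mulr0 addr0 in dxy.
have dx2 := kow_dx_sqr x y s; rewrite F0 mulr0 addr0 in dx2.
have dy2 := kow_dx_sqr y x s; rewrite eval3_sym F0 mulr0 addr0 in dy2.
have disc := kow_discr_s x y.
rewrite /discr -/(polA _) -/(polB _) -/(polC _) kowAE kowBE in disc.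
rewrite /eval3 kowAE kowBE in F0; rewrite kowAE in rel.
have {}F0 : polC kowF x y = - ((x - y) ^+ 2 * s ^+ 2
    + 2 * (polar x y + d * (x - y) ^+ 2) * s).
  by apply/eqP; rewrite -addr_eq0 addrC F0.
have -> : (kow_dx x y s * f1 - kow_dx y x s * f2) ^+ 2 =
  kow_dx x y s ^+ 2 * f1 ^+ 2 + kow_dx y x s ^+ 2 * f2 ^+ 2
  - 2 * (kow_dx x y s * kow_dx y x s) * (f1 * f2) by ring.
rewrite dxy dx2 dy2 f1E f2E f12 -subr_sqr kE /kow_ds.
have -> : 4 * kowP.[y] * kowJ.[s] * (kowP.[x] + e1 * (x - y) ^+ 2) +
  4 * kowP.[x] * kowJ.[s] * (kowP.[y] + e2 * (x - y) ^+ 2) =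
  2 * kowJ.[s] * (4 * kowP.[x] * kowP.[y])
  + 4 * kowJ.[s] * (x - y) ^+ 2 * (kowP.[y] * e1 + kowP.[x] * e2) by ring.
by rewrite rel -disc F0; ring.
Qed.

End KowalevskiPolynomial.

(** * Calculus of complex-valued functions *)

Section ComplexCalculus.
Context {R : realType}.
Local Notation C := R[i].

Lemma ReD (x y : C) : complex.Re (x + y) = complex.Re x + complex.Re y.
Proof. by case: x; case: y. Qed.
Lemma ImD (x y : C) : complex.Im (x + y) = complex.Im x + complex.Im y.
Proof. by case: x; case: y. Qed.
Lemma ReN (x : C) : complex.Re (- x) = - complex.Re x.
Proof. by case: x. Qed.
Lemma ImN (x : C) : complex.Im (- x) = - complex.Im x.
Proof. by case: x. Qed.
Lemma ReM (x y : C) : complex.Re (x * y) =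
  complex.Re x * complex.Re y - complex.Im x * complex.Im y.
Proof. by case: x; case: y. Qed.
Lemma ImM (x y : C) : complex.Im (x * y) =
  complex.Re x * complex.Im y + complex.Im x * complex.Re y.
Proof. by case: x; case: y. Qed.

Section Directional.
Context {V : normedModType R}.
Implicit Types (f g : V -> C) (p v : V).

(** For functions of a real variable and [v = 1] this is convertible to [is_cderive], so the rules
    below serve both for derivatives along a vector field and for time derivatives. *)
Definition is_cdirderive f p v (l : C) : Prop :=
  is_derive p v (fun q => complex.Re (f q) : R) (complex.Re l) /\
  is_derive p v (fun q => complex.Im (f q) : R) (complex.Im l).

Lemma is_cdirderive_eq f p v l m :
  is_cdirderive f p v l -> l = m -> is_cdirderive f p v m.
Proof. by move=> ? <-. Qed.

Lemma is_cdirderive_cst (c : C) p v : is_cdirderive (fun=> c) p v 0.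
Proof. by split; apply: is_derive_cst. Qed.

Lemma is_cdirderive_real (f : V -> R) p v (l : R) :
  is_derive p v f l -> is_cdirderive (fun q => (f q)%:C) p v l%:C.
Proof. by move=> fl; split => //; apply: is_derive_cst. Qed.

Lemma is_cdirderiveD f g p v l m : is_cdirderive f p v l ->
  is_cdirderive g p v m -> is_cdirderive (fun q => f q + g q) p v (l + m).
Proof.
move=> [f1 f2] [g1 g2]; split.
  rewrite ReD (_ : (fun _ => _) = (fun q => complex.Re (f q) : R) +
    (fun q => complex.Re (g q) : R)); first exact: is_deriveD.
  by apply/funext => q; rewrite ReD.
rewrite ImD (_ : (fun _ => _) = (fun q => complex.Im (f q) : R) +
  (fun q => complex.Im (g q) : R)); first exact: is_deriveD.
by apply/funext => q; rewrite ImD.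
Qed.

Lemma is_cdirderiveN f p v l : is_cdirderive f p v l ->
  is_cdirderive (fun q => - f q) p v (- l).
Proof.
move=> [f1 f2]; split.
  rewrite ReN (_ : (fun _ => _) = - (fun q => complex.Re (f q) : R)).
    exact: is_deriveN.
  by apply/funext => q; rewrite ReN.
rewrite ImN (_ : (fun _ => _) = - (fun q => complex.Im (f q) : R)).
  exact: is_deriveN.
by apply/funext => q; rewrite ImN.
Qed.

Lemma is_cdirderiveM f g p v l m : is_cdirderive f p v l ->
  is_cdirderive g p v m ->
  is_cdirderive (fun q => f q * g q) p v (l * g p + f p * m).
Proof.
move=> [f1 f2] [g1 g2]; split.
  have := is_deriveB (is_deriveM f1 g1) (is_deriveM f2 g2).
  rewrite ReD !ReM (_ : _ - _ = (fun q => complex.Re (f q * g q) : R)); last first.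
    by apply/funext => q; rewrite ReM.
  by move=> /is_derive_eq; apply; rewrite /GRing.scale/=; ring.
have := is_deriveD (is_deriveM f1 g2) (is_deriveM f2 g1).
rewrite ImD !ImM (_ : _ + _ = (fun q => complex.Im (f q * g q) : R)); last first.
  by apply/funext => q; rewrite ImM.
by move=> /is_derive_eq; apply; rewrite /GRing.scale/=; ring.
Qed.

Lemma is_cdirderiveX f n p v l : is_cdirderive f p v l ->
  is_cdirderive (fun q => f q ^+ n) p v (n%:R * f p ^+ n.-1 * l).
Proof.
move=> fl; elim: n => [|n IH].
  by rewrite !mul0r; under eq_fun do rewrite expr0; exact: is_cdirderive_cst.
under eq_fun do rewrite exprS; apply: is_cdirderive_eq (is_cdirderiveM fl IH) _.
case: n {IH} => [|n] /=; first by rewrite expr0; ring.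
by rewrite exprS -!natr1; ring.
Qed.

Lemma is_cdirderive_unique f p v l m : is_cdirderive f p v l ->
  is_cdirderive f p v m -> l = m.
Proof.
move=> [[_ f1] [_ f2]] [[_ g1] [_ g2]]; apply/eqP; rewrite eq_complex.
by rewrite -f1 g1 -f2 g2 !eqxx.
Qed.

Lemma is_cdirderive_cdirderiv f p v l :
  is_cdirderive f p v l -> cdirderiv f p v = l.
Proof. by move=> [[_ f1] [_ f2]]; rewrite /cdirderiv f1 f2; case: l {f1 f2}. Qed.

End Directional.

Lemma is_cderive_chain (f : phase R -> C) (p : R -> phase R) (t : R)
  (v : phase R) (l : C) : cdifferentiable_at f (p t) ->
  is_cdirderive f (p t) v l -> is_derive t (1 : R) p v ->
  is_cderive (f \o p) t l.
Proof.
have chain (g : phase R -> R) (m : R) : differentiable g (p t) ->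
    is_derive (p t) v g m -> is_derive t (1 : R) p v ->
    is_derive t (1 : R) (g \o p) m.
  move=> dg [_ gm] [dp pv]; have dp' := (derivable1_diffP _ _).1 dp.
  have dgp : differentiable (g \o p) t by apply: differentiable_comp.
  apply: DeriveDef; first exact/derivable1_diffP.
  by rewrite deriveE// diff_comp//= (_ : 'd p t 1 = v) -?deriveE.
by move=> [d1 d2] [f1 f2] dp; split; exact: chain.
Qed.

Lemma is_cderive_continuous (f : R -> C) t l :
  is_cderive f t l -> ccontinuous_at f t.
Proof.
by move=> [[f1 _] [f2 _]]; split; apply/differentiable_continuous/derivable1_diffP.
Qed.

Lemma near_is_cderive (f g : R -> C) t l :
  (\forall u \near t, f u = g u) -> is_cderive f t l -> is_cderive g t l.
Proof.
move=> fg [f1 f2]; split; [apply: near_eq_is_derive f1|apply: near_eq_is_derive f2];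
  by apply: filterS fg => u ->.
Qed.

Lemma is_derive_cvg (f : R -> R) (t l : R) :
  (fun h => h^-1 * (f (h + t) - f t)) @ 0^' --> l <-> is_derive t (1 : R) f l.
Proof.
have E : (fun h => h^-1 * (f (h + t) - f t)) =
         (fun h => h^-1 *: ((f \o shift t) (h *: (1 : R)) - f t)).
  by apply/funext => h; rewrite /= /GRing.scale/= mulr1.
rewrite E; split=> [fl|[df <-]].
  by apply: DeriveDef; [apply/cvg_ex; exists l | exact: cvg_lim].
exact: df.
Qed.

(** The difference quotient of [d] is that of [g] divided by [d (h + t) + d t]. By continuity of [d]
    this sum tends to [2 * d t], which is nonzero. *)
Lemma is_cderive_sqrt (d g : R -> C) (t : R) (l : C) :
  (\forall u \near t, d u ^+ 2 = g u) -> ccontinuous_at d t -> d t != 0 ->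
  is_cderive g t l -> is_cderive d t (l / (2 * d t)).
Proof.
move=> dg [ca cb] d0 [/is_derive_cvg gu /is_derive_cvg gv].
set a := fun u : R => complex.Re (d u) : R.
set b := fun u : R => complex.Im (d u) : R.
have shiftt : h + t @[h --> (0 : R)^'] --> t.
  have : h + t @[h --> (0 : R)^'] --> 0 + t.
    by apply: cvgD; [exact: nbhs_dnbhs | exact: cvg_cst].
  by rewrite add0r.
have shiftc (f : R -> R) : {for t, continuous f} -> f (h + t) @[h --> 0^'] --> f t.
  by move=> cf; apply: (@cvg_comp _ _ _ (fun h => h + t) f _ (nbhs t)).
have [dgt aa bb] : [/\ d t ^+ 2 = g t, a (h + t) @[h --> 0^'] --> a t &
    b (h + t) @[h --> 0^'] --> b t].
  by split; [exact: nbhs_singleton dg | exact: shiftc | exact: shiftc].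
have dg' : \forall h \near 0^', d (h + t) ^+ 2 = g (h + t) := shiftt _ dg.
set gr := fun h : R => h^-1 * (complex.Re (g (h + t)) - complex.Re (g t)) in gu.
set gi := fun h : R => h^-1 * (complex.Im (g (h + t)) - complex.Im (g t)) in gv.
(* The real and imaginary parts of the sum [d (h + t) + d t]; [D] is its squared modulus, which
   appears when the complex division is carried out on real and imaginary parts. *)
pose sr h := a (h + t) + a t; pose si h := b (h + t) + b t.
pose D h := sr h ^+ 2 + si h ^+ 2.
have srl : sr h @[h --> 0^'] --> a t + a t by apply: cvgD => //; exact: cvg_cst.
have sil : si h @[h --> 0^'] --> b t + b t by apply: cvgD => //; exact: cvg_cst.
have Dl : D h @[h --> 0^'] --> (a t + a t) ^+ 2 + (b t + b t) ^+ 2.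
  by rewrite /D; apply: cvgD; under eq_fun do rewrite expr2; rewrite expr2; apply: cvgM.
have D0 : (a t + a t) ^+ 2 + (b t + b t) ^+ 2 != 0.
  rewrite paddr_eq0 ?sqr_ge0// !sqrf_eq0 -!mulr2n !mulrn_eq0/=.
  by move: d0; rewrite eq_complex.
have Dn0 : \forall h \near 0^', D h != 0.
  by move/cvgr_neq0 : Dl; apply.
set m := l / (2 * d t).
have lE : l = m * (2 * d t) by rewrite divfK// mulf_neq0// pnatr_eq0.
have ReE : complex.Re m = (complex.Re l * (a t + a t) +
    complex.Im l * (b t + b t)) / ((a t + a t) ^+ 2 + (b t + b t) ^+ 2).
  by apply: canRL (mulfK D0) _; rewrite lE mulr_natl !(ReM, ImM, mulr2n, ReD, ImD) /a /b; ring.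
have ImE : complex.Im m = (complex.Im l * (a t + a t) -
    complex.Re l * (b t + b t)) / ((a t + a t) ^+ 2 + (b t + b t) ^+ 2).
  by apply: canRL (mulfK D0) _; rewrite lE mulr_natl !(ReM, ImM, mulr2n, ReD, ImD) /a /b; ring.
split; apply/is_derive_cvg.
  rewrite ReE.
  have : (gr h * sr h + gi h * si h) / D h @[h --> 0^'] -->
     (complex.Re l * (a t + a t) + complex.Im l * (b t + b t)) /
     ((a t + a t) ^+ 2 + (b t + b t) ^+ 2).
    by apply: cvgM; [apply: cvgD; apply: cvgM | exact: cvgV].
  apply: cvg_trans; apply: near_eq_cvg; near=> h.
  have Dh : D h != 0 by near: h.
  apply/esym/(canRL (mulfK Dh)); rewrite /gr /gi -dgt.
  rewrite -(_ : d (h + t) ^+ 2 = g (h + t)); last by near: h.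
  by rewrite !expr2 !(ReM, ImM) /D /sr /si /a /b; ring.
rewrite ImE.
have : (gi h * sr h - gr h * si h) / D h @[h --> 0^'] -->
   (complex.Im l * (a t + a t) - complex.Re l * (b t + b t)) /
   ((a t + a t) ^+ 2 + (b t + b t) ^+ 2).
  by apply: cvgM; [apply: cvgB; apply: cvgM | exact: cvgV].
apply: cvg_trans; apply: near_eq_cvg; near=> h.
have Dh : D h != 0 by near: h.
apply/esym/(canRL (mulfK Dh)); rewrite /gr /gi -dgt.
rewrite -(_ : d (h + t) ^+ 2 = g (h + t)); last by near: h.
by rewrite !expr2 !(ReM, ImM) /D /sr /si /a /b; ring.
Unshelve. all: by end_near.
Qed.

(** The inverse is the conjugate divided by the squared modulus [N]. Only existence is recorded, the
    value never being used. *)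
Lemma is_cderiveV (f : R -> C) (t : R) l : f t != 0 -> is_cderive f t l ->
  exists m, is_cderive (fun u => (f u)^-1) t m.
Proof.
move=> f0 [fr fi].
pose N u : R := complex.Re (f u) * complex.Re (f u) + complex.Im (f u) * complex.Im (f u).
have EV : (fun u => (f u)^-1) = fun u => ((N u)^-1)%:C *
    ((complex.Re (f u))%:C + 'i%C * - (complex.Im (f u))%:C).
  apply/funext => u; rewrite /N; case: (f u) => x y /=.
  apply/eqP; rewrite eq_complex /=; apply/andP; split; apply/eqP.
    by simpc => /=; rewrite !expr2; ring.
  by simpc => /=; rewrite !expr2; ring.
have N0 : N t != 0.
  by rewrite paddr_eq0 -?expr2 ?sqr_ge0// !sqrf_eq0; move: f0; rewrite eq_complex.
have [dN _] : is_derive t (1 : R) N _ := is_deriveD (is_deriveM fr fr) (is_deriveM fi fi).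
have dV := derivableP (derivableV N0 dN).
eexists; rewrite EV; apply: is_cdirderiveM; first exact: is_cdirderive_real dV.
apply: is_cdirderiveD; first exact: is_cdirderive_real fr.
apply: is_cdirderiveM; first exact: is_cdirderive_cst.
by apply: is_cdirderiveN; exact: is_cdirderive_real fi.
Qed.

Lemma is_derive0_eq (D : set R) (f : R -> R) : is_interval D ->
  (forall t, D t -> is_derive t (1 : R) f 0) ->
  forall t u, D t -> D u -> f t = f u.
Proof.
move=> iD fD; suff E t u : t < u -> D t -> D u -> f t = f u.
  move=> t u; case: (ltgtP t u) => [|ut Dt Du|->//]; first exact: E.
  by apply/esym/E.
move=> tu Dt Du.
have tuD x : x \in `[t, u] -> D x.
  by rewrite in_itv/= => /andP[tx xu]; apply: (iD t u) => //; rewrite tx.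
have [] := @MVT R f (fun=> 0) t u tu.
- by move=> x xtu; apply/fD/tuD; exact: subset_itv_oo_cc.
- by apply: derivable_within_continuous => x /tuD /fD [].
- by move=> c _ /eqP; rewrite mul0r subr_eq0 => /eqP.
Qed.

Lemma is_cderive0_eq (D : set R) (f : R -> C) : is_interval D ->
  (forall t, D t -> is_cderive f t 0) ->
  forall t u, D t -> D u -> f t = f u.
Proof.
move=> iD fD t u Dt Du; apply/eqP; rewrite eq_complex; apply/andP; split; apply/eqP.
  by apply: (is_derive0_eq (f := fun u => complex.Re (f u)) iD) => // v /fD [].
by apply: (is_derive0_eq (f := fun u => complex.Im (f u)) iD) => // v /fD [].
Qed.

End ComplexCalculus.

(** * Square-freeness and degree of the curve polynomial *)

Section GenusTwo.
Context {R : realType}.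
Local Notation C := R[i].
Implicit Types h b n d k : C.

(* A constant multiple of the discriminant of J, which the shift d leaves
   unchanged. *)
Definition kow_disc h b n : C :=
  n * (12 * n - 4 * h ^+ 2) ^+ 2
  + 2 * h * (12 * n - 4 * h ^+ 2) * (9 * b ^+ 2 - 16 * h * n)
  + 3 * (9 * b ^+ 2 - 16 * h * n) ^+ 2.

Lemma kowJ_separable h b n d : kow_disc h b n != 0 ->
  separable_poly (kowJ h b n d).
Proof.
move=> D0; rewrite unlock; apply/Bezout_coprimepP.
pose Y : {poly C} := 'X + d%:P.
(* Euclid's algorithm in [Y]: first [9 J = (3 Y - h) J' - (u Y + v)], then [u^2 J' + 2 (3 u Y - 2 h
   u - 3 v) (u Y + v) = - 2 kow_disc]. Eliminating [u Y + v] gives the Bezout cofactors; no division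
   by [u] takes place. *)
pose u := 12 * n - 4 * h ^+ 2; pose v := 9 * b ^+ 2 - 16 * h * n.
exists (18 * (3 * u%:P * Y - (2 * h * u + 3 * v)%:P),
  - ((u ^+ 2)%:P + 2 * (3 * u%:P * Y - (2 * h * u + 3 * v)%:P) * (3 * Y - h%:P))).
have -> : (kowJ h b n d)^`() =
    2 * (2 * (h%:P - Y) * Y - (Y ^+ 2 + n%:P)).
  rewrite /kowJ derivB derivC derivZ derivM derivB derivC derivX derivD derivC.
  by rewrite deriv_exp derivD derivX derivC -mul_polyC /Y /=; ring.
set q := (X in X %= 1).
suff -> : q = (2 * kow_disc h b n)%:P by rewrite polyC_eqp1 mulf_neq0 ?pnatr_eq0.
by rewrite /q /= /kowJ /kow_disc /Y /u /v -mul_polyC; ring.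
Qed.

Lemma size_kowJ h b n d : size (kowJ h b n d) = 4%N.
Proof.
have sY : size (('X + d%:P) ^+ 2 + n%:P) = 3%N.
  have s2 : size (('X + d%:P) ^+ 2) = 3%N.
    by rewrite expr2 size_mul ?size_XaddC// -size_poly_eq0 size_XaddC.
  by rewrite size_polyDl s2// size_polyC; case: (n != 0).
have sF : size (2 *: (((h - d)%:P - 'X) * (('X + d%:P) ^+ 2 + n%:P))) = 4%N.
  rewrite size_scale ?pnatr_eq0// -opprB mulNr size_polyN size_mul ?sY ?size_XsubC//.
    by rewrite -size_poly_eq0 size_XsubC.
  by rewrite -size_poly_eq0 sY.
by rewrite /kowJ size_polyDl sF // size_polyN size_polyC; case: (_ != 0).
Qed.

(** The degree is 3 + 2 = 5. The factors are square-free and pairwise coprime: [k] and [- k] are not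
    roots of J, and they differ because [k] is nonzero. *)
Lemma genus_two_cubic (J : {poly C}) (lambda k : C) : size J = 4%N ->
  separable_poly J -> lambda != 0 -> k != 0 -> J.[k] * J.[- k] != 0 ->
  genus_two (curve_poly lambda J k).
Proof.
move=> sJ sepJ l0 k0; rewrite mulf_eq0 negb_or => /andP[Jk JNk].
have J0 : J != 0 by rewrite -size_poly_eq0 sJ.
have s1 : size (J * ('X - k%:P)) = 5%N by rewrite size_mul ?polyXsubC_eq0// sJ size_XsubC.
have kE : 'X + k%:P = 'X - (- k)%:P :> {poly C} by rewrite rmorphN opprK.
rewrite /genus_two /curve_poly kE; split.
  rewrite size_scale// size_mul ?polyXsubC_eq0 ?mulf_neq0 ?polyXsubC_eq0//.
  by rewrite s1 size_XsubC.
rewrite (eqp_separable (eqp_scale _ l0)) !separable_root sepJ /=.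
apply/andP; split; first exact: Jk.
rewrite /root hornerM hornerXsubC mulf_neq0//.
by rewrite -opprD oppr_eq0 -mulr2n mulrn_eq0.
Qed.

End GenusTwo.

(** * Polynomial functions on the phase space *)

Section PolynomialFunctions.
Context {R : realType}.
Local Notation C := R[i].
Local Notation phase := (phase R).

(** The two consequences of being polynomial that the argument draws on: differentiability, for
    derivatives and for open nonvanishing sets, and polynomial restriction to every line, for
    density. *)
Definition polyfun (f : phase -> R) : Prop :=
  (forall p, differentiable f p) /\
  forall p v, exists q : {poly R}, forall t, f (p + t *: v) = q.[t].

Lemma polyfun_cst c : polyfun (fun=> c).
Proof.
by split=> [p|p v]; [exact: differentiable_cst | exists c%:P => t; rewrite hornerC].
Qed.

Lemma polyfunD f g : polyfun f -> polyfun g -> polyfun (fun p => f p + g p).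
Proof.
move=> [df pf] [dg pg]; split=> [p|p v]; first exact: differentiableD.
have [q qE] := pf p v; have [r rE] := pg p v.
by exists (q + r) => t; rewrite hornerD qE rE.
Qed.

Lemma polyfunM f g : polyfun f -> polyfun g -> polyfun (fun p => f p * g p).
Proof.
move=> [df pf] [dg pg]; split=> [p|p v]; first exact: differentiableM.
have [q qE] := pf p v; have [r rE] := pg p v.
by exists (q * r) => t; rewrite hornerM qE rE.
Qed.

Lemma polyfunN f : polyfun f -> polyfun (fun p => - f p).
Proof.
move=> [df pf]; split=> [p|p v]; first exact: differentiableN.
by have [q qE] := pf p v; exists (- q) => t; rewrite hornerN qE.
Qed.

Lemma Mc_linear i a (p q : phase) : Mc i (a *: p + q) = a * Mc i p + Mc i q.
Proof. by rewrite /Mc /= !mxE. Qed.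

Lemma gc_linear i a (p q : phase) : gc i (a *: p + q) = a * gc i p + gc i q.
Proof. by rewrite /gc /= !mxE. Qed.

Lemma linear_fun_differentiable (f : phase -> R) (p : phase) :
  (forall a x y, f (a *: x + y) = a * f x + f y) -> continuous f ->
  differentiable f p.
Proof.
move=> fl fc; pose fL := GRing.isLinear.Build _ _ _ _ _ fl.
pose g : {linear phase -> R} := HB.pack f fL.
by rewrite (_ : f = g)//; apply: linear_differentiable.
Qed.

Lemma Mc_differentiable i p : differentiable (@Mc R i) p.
Proof.
apply: linear_fun_differentiable => [|q]; first exact: Mc_linear.
by apply: (@continuous_comp _ _ _ fst (fun N : 'rV[R]_3 => N 0 i : R));
  [exact: cvg_fst | exact: coord_continuous].
Qed.

Lemma gc_differentiable i p : differentiable (@gc R i) p.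
Proof.
apply: linear_fun_differentiable => [|q]; first exact: gc_linear.
by apply: (@continuous_comp _ _ _ snd (fun N : 'rV[R]_3 => N 0 i : R));
  [exact: cvg_snd | exact: coord_continuous].
Qed.

Lemma is_derive_linear (f : phase -> R) (p v : phase) :
  (forall a x y, f (a *: x + y) = a * f x + f y) -> is_derive p v f (f v).
Proof.
move=> fl.
have E : \forall h \near (0 : R)^', f v = h^-1 *: ((f \o shift p) (h *: v) - f p).
  near=> h; have h0 : h != 0 by near: h; exact: nbhs_dnbhs_neq.
  by rewrite /= fl addrK /GRing.scale/= mulKf.
have L : (fun h => h^-1 *: ((f \o shift p) (h *: v) - f p)) @ (0 : R)^' --> f v.
  have C0 : (fun=> f v) @ (0 : R)^' --> f v by exact: cvg_cst.
  by apply: cvg_trans C0; apply: near_eq_cvg; exact: E.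
by apply: DeriveDef; [apply/cvg_ex; exists (f v) | exact: cvg_lim].
Unshelve. all: by end_near.
Qed.

Lemma is_derive_Mc i (p v : phase) : is_derive p v (Mc i) (Mc i v).
Proof. by apply: is_derive_linear; exact: Mc_linear. Qed.

Lemma is_derive_gc i (p v : phase) : is_derive p v (gc i) (gc i v).
Proof. by apply: is_derive_linear; exact: gc_linear. Qed.

Lemma polyfun_Mc i : polyfun (Mc i).
Proof.
split=> [p|p v]; first exact: Mc_differentiable.
exists ((Mc i p)%:P + (Mc i v) *: 'X) => t.
by rewrite addrC Mc_linear !hornerE addrC mulrC.
Qed.

Lemma polyfun_gc i : polyfun (gc i).
Proof.
split=> [p|p v]; first exact: gc_differentiable.
exists ((gc i p)%:P + (gc i v) *: 'X) => t.
by rewrite addrC gc_linear !hornerE addrC mulrC.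
Qed.

(** For density, restrict [f] to the line from an arbitrary point [p] to [p0]: this polynomial in
    one variable is nonzero at parameter 1, so it has finitely many roots and is nonzero at
    parameters arbitrarily close to 0. *)
Lemma polyfun_generically (f : phase -> R) p0 :
  polyfun f -> f p0 != 0 -> generically (fun p => f p != 0).
Proof.
move=> [df pf] f0; exists [set p | f p != 0]; split=> //.
  rewrite (_ : [set _ | _] = f @^-1` [set x | x != 0])//.
  apply: open_comp; last exact: open_neq.
  by move=> p _; apply: differentiable_continuous.
move=> O [p Op] oO; have [q qE] := pf p (p0 - p).
have q0 : q != 0.
  apply: contraNneq f0 => q0.
  by have := qE 1; rewrite q0 horner0 scale1r addrC subrK => ->.
have pc : p + t *: (p0 - p) @[t --> (0 : R)] --> p.
  rewrite -[X in _ --> X]addr0 -(scale0r (p0 - p)).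
  by apply: cvgD; [exact: cvg_cst | apply: cvgZr_tmp].
have [e /= e0 eO] : \forall t \near (0 : R), O (p + t *: (p0 - p)).
  by apply: pc; apply: open_nbhs_nbhs.
(* These are [size q] distinct parameters, one more than the degree of [q], so they are not all
   roots. Denominators start at 2 to keep every parameter strictly below [e]. *)
pose s := [seq e / (i.+2)%:R | i <- iota 0 (size q)].
have us : uniq s.
  rewrite map_inj_uniq ?iota_uniq// => i j /(mulfI (lt0r_neq0 e0)) /invr_inj.
  by move=> /eqP; rewrite eqr_nat => /eqP [].
have /allPn [t ts tq] : ~~ all (root q) s.
  by apply/negP => /(max_poly_roots q0)/(_ us); rewrite size_map size_iota ltnn.
exists (p + t *: (p0 - p)); split; last by rewrite /= qE.
apply: eO; rewrite /= sub0r normrN.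
move: ts => /mapP[i _ ->]; rewrite gtr0_norm ?divr_gt0//.
by rewrite ltr_pdivrMr// ltr_pMr// ltr1n.
Qed.

Lemma generically_and (Q1 Q2 : phase -> Prop) : generically Q1 ->
  generically Q2 -> generically (fun p => Q1 p /\ Q2 p).
Proof.
move=> [U [oU dU UQ]] [W [oW dW WQ]]; exists (U `&` W); split.
- exact: openI.
- move=> O O0 oO; rewrite setIA; apply: dW; last exact: openI.
  exact: dU.
- by move=> p [/UQ ? /WQ].
Qed.

Lemma generically_sub (Q1 Q2 : phase -> Prop) : (forall p, Q1 p -> Q2 p) ->
  generically Q1 -> generically Q2.
Proof.
by move=> Q12 [U [oU dU UQ]]; exists U; split=> // p /UQ /Q12.
Qed.

Definition cpolyfun (f : phase -> C) : Prop :=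
  polyfun (fun p => complex.Re (f p)) /\ polyfun (fun p => complex.Im (f p)).

Lemma cpolyfun_cst c : cpolyfun (fun=> c).
Proof. by split; exact: polyfun_cst. Qed.

Lemma cpolyfun_real f : polyfun f -> cpolyfun (fun p => (f p)%:C).
Proof. by move=> pf; split=> //; exact: polyfun_cst. Qed.

Lemma cpolyfunD f g : cpolyfun f -> cpolyfun g -> cpolyfun (fun p => f p + g p).
Proof.
move=> [f1 f2] [g1 g2]; split.
  by under eq_fun do rewrite ReD; exact: polyfunD.
by under eq_fun do rewrite ImD; exact: polyfunD.
Qed.

Lemma cpolyfunN f : cpolyfun f -> cpolyfun (fun p => - f p).
Proof.
move=> [f1 f2]; split.
  by under eq_fun do rewrite ReN; exact: polyfunN.
by under eq_fun do rewrite ImN; exact: polyfunN.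
Qed.

Lemma cpolyfunM f g : cpolyfun f -> cpolyfun g -> cpolyfun (fun p => f p * g p).
Proof.
move=> [f1 f2] [g1 g2]; split.
  under eq_fun do rewrite ReM.
  by apply: polyfunD; [|apply: polyfunN]; exact: polyfunM.
by under eq_fun do rewrite ImM; apply: polyfunD; exact: polyfunM.
Qed.

Lemma cpolyfunX f n : cpolyfun f -> cpolyfun (fun p => f p ^+ n).
Proof.
move=> pf; elim: n => [|n IH]; first by under eq_fun do rewrite expr0; exact: cpolyfun_cst.
by under eq_fun do rewrite exprS; exact: cpolyfunM.
Qed.

Lemma cpolyfun_cdifferentiable f p : cpolyfun f -> cdifferentiable_at f p.
Proof. by move=> [[d1 _] [d2 _]]; split. Qed.

Lemma cpolyfun_generically (f : phase -> C) p0 :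
  cpolyfun f -> f p0 != 0 -> generically (fun p => f p != 0).
Proof.
move=> [f1 f2]; rewrite eq_complex negb_and => /orP[] n0.
  apply: generically_sub (polyfun_generically f1 n0) => p.
  by rewrite [f p == 0]eq_complex; move=> /negbTE ->.
apply: generically_sub (polyfun_generically f2 n0) => p.
by rewrite [f p == 0]eq_complex; move=> /negbTE ->; rewrite andbF.
Qed.

End PolynomialFunctions.

(** * The Sokolov system *)

Section Coordinates.
Context {R : realType}.
Local Notation C := R[i].
Local Notation phase := (phase R).

(** The real coordinates are embedded in the complex numbers, so that all functions of the system
    become polynomial expressions in them and ['i%C], within reach of the tactics below and of
    [ring]. *)
Definition cM (i : 'I_3) (p : phase) : C := (Mc i p)%:C.
Definition cg (i : 'I_3) (p : phase) : C := (gc i p)%:C.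

Lemma cpolyfun_cM i : cpolyfun (cM i).
Proof. exact/cpolyfun_real/polyfun_Mc. Qed.
Lemma cpolyfun_cg i : cpolyfun (cg i).
Proof. exact/cpolyfun_real/polyfun_gc. Qed.

Lemma is_cdirderive_cM i p v : is_cdirderive (cM i) p v (cM i v).
Proof. exact/is_cdirderive_real/is_derive_Mc. Qed.
Lemma is_cdirderive_cg i p v : is_cdirderive (cg i) p v (cg i v).
Proof. exact/is_cdirderive_real/is_derive_gc. Qed.

End Coordinates.

(** Symbolic differentiation by recursion on the expression; [cderive] leaves only the equality
    between the computed and the announced derivative. *)
Ltac cderive_step := match goal with
  | |- is_cdirderive (fun q => @GRing.add _ _ _) _ _ _ => apply: is_cdirderiveD
  | |- is_cdirderive (fun q => @GRing.opp _ _) _ _ _ => apply: is_cdirderiveN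
  | |- is_cdirderive (fun q => @GRing.exp _ _ _) _ _ _ => apply: is_cdirderiveX
  | |- is_cdirderive (fun q => @GRing.mul _ _ _) _ _ _ => apply: is_cdirderiveM
  | |- is_cdirderive (fun q => ?c) _ _ _ => exact: (is_cdirderive_cst c)
  | |- _ => eassumption
  | |- _ => exact: is_cdirderive_cM
  | |- _ => exact: is_cdirderive_cg
  end.
Ltac cderive := apply: is_cdirderive_eq; [repeat cderive_step |].

Ltac cpoly_step := match goal with
  | |- cpolyfun (fun q => @GRing.add _ _ _) => apply: cpolyfunD
  | |- cpolyfun (fun q => @GRing.opp _ _) => apply: cpolyfunN
  | |- cpolyfun (fun q => @GRing.exp _ _ _) => apply: cpolyfunX
  | |- cpolyfun (fun q => @GRing.mul _ _ _) => apply: cpolyfunM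
  | |- cpolyfun (fun q => ?c) => exact: (cpolyfun_cst c)
  | |- _ => eassumption
  | |- _ => exact: cpolyfun_cM
  | |- _ => exact: cpolyfun_cg
  end.
Ltac cpoly := repeat cpoly_step.

Section Sokolov.
Variables (R : realType) (c1 c2 : R).
Local Notation C := R[i].
Local Notation phase := (phase R).

Definition cH (p : phase) : C :=
  cM 0 p ^+ 2 + cM 1 p ^+ 2 + 2 * cM 2 p ^+ 2 + 2 * c1%:C * cg 0 p
  + 2 * c2%:C * (cg 1 p * cM 2 p - cg 2 p * cM 1 p).

Lemma cHE p : (sokolov_hamiltonian c1 c2 p)%:C = cH p.
Proof. by rewrite /sokolov_hamiltonian /cH /cM /cg; ring. Qed.

Lemma complexMi (x y : R) : x +i* y = x%:C + 'i%C * y%:C.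
Proof. by rewrite [LHS]complexE. Qed.

Lemma sokolov_z1E : @sokolov_z1 R = fun p => cM 0 p + 'i%C * cM 1 p.
Proof. by apply/funext => p; rewrite /sokolov_z1 complexMi. Qed.

Lemma sokolov_z2E : @sokolov_z2 R = fun p => cM 0 p - 'i%C * cM 1 p.
Proof. by apply/funext => p; rewrite /sokolov_z2 complexMi rmorphN mulrN. Qed.

Definition ca (p : phase) : C := cg 0 p ^+ 2 + cg 1 p ^+ 2 + cg 2 p ^+ 2.
Definition cb (p : phase) : C := cM 0 p * cg 0 p + cM 1 p * cg 1 p + cM 2 p * cg 2 p.

Lemma caE p : (casimir_a p)%:C = ca p.
Proof. by rewrite /casimir_a /ca /cg; ring. Qed.

Lemma sokolov_e1E : sokolov_e1 c1 c2 = fun p =>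
  (cM 0 p + 'i%C * cM 1 p) ^+ 2 - 2 * c1%:C * (cg 0 p + 'i%C * cg 1 p)
  - c2%:C ^+ 2 * ca p
  - c2%:C * (2 * cg 1 p * cM 2 p - 2 * cg 2 p * cM 1 p
     + 'i%C * (2 * (cg 2 p * cM 0 p - cg 0 p * cM 2 p))).
Proof.
apply/funext => p; rewrite /sokolov_e1 sokolov_z1E caE (complexMi (gc 0 p)) (complexMi (_ - _)).
by rewrite /cM /cg; ring.
Qed.

Lemma sokolov_e2E : sokolov_e2 c1 c2 = fun p =>
  (cM 0 p - 'i%C * cM 1 p) ^+ 2 - 2 * c1%:C * (cg 0 p - 'i%C * cg 1 p)
  - c2%:C ^+ 2 * ca p
  - c2%:C * (2 * cg 1 p * cM 2 p - 2 * cg 2 p * cM 1 p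
     - 'i%C * (2 * (cg 2 p * cM 0 p - cg 0 p * cM 2 p))).
Proof.
apply/funext => p; rewrite /sokolov_e2 sokolov_z2E caE (complexMi (gc 0 p)) (complexMi (_ - _)).
by rewrite /cM /cg; ring.
Qed.

Lemma derive_Mc i (p v : phase) : 'D_v (Mc i) p = Mc i v.
Proof. by have [_ ->] := is_derive_Mc i p v. Qed.
Lemma derive_gc i (p v : phase) : 'D_v (gc i) p = gc i v.
Proof. by have [_ ->] := is_derive_gc i p v. Qed.

Lemma derive_hamiltonian (p v : phase) : 'D_v (sokolov_hamiltonian c1 c2) p =
  2 * Mc 0 p * Mc 0 v + 2 * (Mc 1 p - c2 * gc 2 p) * Mc 1 v
  + (4 * Mc 2 p + 2 * c2 * gc 1 p) * Mc 2 v + 2 * c1 * gc 0 v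
  + 2 * c2 * Mc 2 p * gc 1 v - 2 * c2 * Mc 1 p * gc 2 v.
Proof.
(* The complexified Hamiltonian is differentiated symbolically, and the real derivative is read off
   as the real part. *)
have : is_cdirderive cH p v (2 * Mc 0 p * Mc 0 v + 2 * (Mc 1 p - c2 * gc 2 p) * Mc 1 v
  + (4 * Mc 2 p + 2 * c2 * gc 1 p) * Mc 2 v + 2 * c1 * gc 0 v
  + 2 * c2 * Mc 2 p * gc 1 v - 2 * c2 * Mc 1 p * gc 2 v)%:C.
  rewrite /cH; cderive.
  by rewrite /cM /cg; ring.
rewrite (_ : cH = fun p => (sokolov_hamiltonian c1 c2 p)%:C); first by case=> [[_]].
by apply/funext => q; rewrite cHE.
Qed.

End Sokolov.

(** * The Sokolov vector field, the evolution of z1, z2, e1, e2, and the constants of motion *)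

Section SokolovField.
Variables (R : realType) (c1 c2 : R).
Local Notation C := R[i].
Local Notation phase := (phase R).
Local Notation V := (sokolov_field c1 c2).

Lemma Mc_eM i j : Mc i (eM R j) = (i == j)%:R.
Proof. by rewrite /Mc /eM /= mxE eqxx. Qed.
Lemma Mc_eg i j : Mc i (eg R j) = 0.
Proof. by rewrite /Mc /eg /= mxE. Qed.
Lemma gc_eM i j : gc i (eM R j) = 0.
Proof. by rewrite /gc /eM /= mxE. Qed.
Lemma gc_eg i j : gc i (eg R j) = (i == j)%:R.
Proof. by rewrite /gc /eg /= mxE eqxx. Qed.

Lemma cM_eM i j : cM i (eM R j) = (i == j)%:R.
Proof. by rewrite /cM Mc_eM rmorph_nat. Qed.
Lemma cM_eg i j : cM i (eg R j) = 0.
Proof. by rewrite /cM Mc_eg. Qed.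
Lemma cg_eM i j : cg i (eM R j) = 0.
Proof. by rewrite /cg gc_eM. Qed.
Lemma cg_eg i j : cg i (eg R j) = (i == j)%:R.
Proof. by rewrite /cg gc_eg rmorph_nat. Qed.

Lemma big_ord3 (S : nmodType) (F : 'I_3 -> S) : \sum_(i < 3) F i = F 0 + F 1 + F 2.
Proof.
rewrite !big_ord_recr big_ord0 /= add0r.
by congr (F _ + F _ + F _); apply: val_inj.
Qed.

Local Notation H := (sokolov_hamiltonian c1 c2).

Lemma Mc_field i p : Mc i (V p) = poisson (Mc i) H p.
Proof. exact: mxE. Qed.
Lemma gc_field i p : gc i (V p) = poisson (gc i) H p.
Proof. exact: mxE. Qed.

Lemma poissonE (f h : phase -> R) p : poisson f h p =
  ('D_(eM R 0) f p * 'D_(eM R 1) h p - 'D_(eM R 1) f p * 'D_(eM R 0) h p) * Mc 2 p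
  + ('D_(eM R 1) f p * 'D_(eM R 2) h p - 'D_(eM R 2) f p * 'D_(eM R 1) h p) * Mc 0 p
  + ('D_(eM R 2) f p * 'D_(eM R 0) h p - 'D_(eM R 0) f p * 'D_(eM R 2) h p) * Mc 1 p
  + ('D_(eM R 0) f p * 'D_(eg R 1) h p - 'D_(eg R 1) f p * 'D_(eM R 0) h p
     + 'D_(eg R 0) f p * 'D_(eM R 1) h p - 'D_(eM R 1) f p * 'D_(eg R 0) h p) * gc 2 p
  + ('D_(eM R 1) f p * 'D_(eg R 2) h p - 'D_(eg R 2) f p * 'D_(eM R 1) h p
     + 'D_(eg R 1) f p * 'D_(eM R 2) h p - 'D_(eM R 2) f p * 'D_(eg R 1) h p) * gc 0 p
  + ('D_(eM R 2) f p * 'D_(eg R 0) h p - 'D_(eg R 0) f p * 'D_(eM R 2) h p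
     + 'D_(eg R 2) f p * 'D_(eM R 0) h p - 'D_(eM R 0) f p * 'D_(eg R 2) h p) * gc 1 p.
Proof.
rewrite /poisson.
set fM := fun i => 'D_(eM R i) f p; set fg := fun i => 'D_(eg R i) f p.
set hM := fun i => 'D_(eM R i) h p; set hg := fun i => 'D_(eg R i) h p.
transitivity (\sum_(i < 3) \sum_(j < 3) \sum_(k < 3) epsilon R i j k *
  (fM i * hM j * Mc k p + (fM i * hg j - fg j * hM i) * gc k p)) => //.
rewrite -!/(fM _) -!/(fg _) -!/(hM _) -!/(hg _).
move: fM fg hM hg => fM fg hM hg.
by rewrite !(big_ord3 (fun=> _)) /epsilon /=; ring.
Qed.

Let fieldE := (Mc_field, gc_field, poissonE, derive_Mc, derive_gc,
  derive_hamiltonian, Mc_eM, Mc_eg, gc_eM, gc_eg).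

Lemma field_M0 p : Mc 0 (V p) = - 2 * Mc 1 p * Mc 2 p.
Proof. by rewrite !fieldE /=; ring. Qed.

Lemma field_M1 p : Mc 1 (V p) = 2 * Mc 0 p * Mc 2 p
  + 2 * c2 * (gc 1 p * Mc 0 p - gc 0 p * Mc 1 p) - 2 * c1 * gc 2 p.
Proof. by rewrite !fieldE /=; ring. Qed.

Lemma field_M2 p : Mc 2 (V p) =
  2 * c2 * (gc 2 p * Mc 0 p - gc 0 p * Mc 2 p) + 2 * c1 * gc 1 p.
Proof. by rewrite !fieldE /=; ring. Qed.

Lemma field_g0 p : gc 0 (V p) = 2 * (Mc 1 p - c2 * gc 2 p) * gc 2 p
  - (4 * Mc 2 p + 2 * c2 * gc 1 p) * gc 1 p.
Proof. by rewrite !fieldE /=; ring. Qed.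

Lemma field_g1 p : gc 1 (V p) =
  (4 * Mc 2 p + 2 * c2 * gc 1 p) * gc 0 p - 2 * Mc 0 p * gc 2 p.
Proof. by rewrite !fieldE /=; ring. Qed.

Lemma field_g2 p : gc 2 (V p) =
  2 * Mc 0 p * gc 1 p - 2 * (Mc 1 p - c2 * gc 2 p) * gc 0 p.
Proof. by rewrite !fieldE /=; ring. Qed.

Definition field_coordE :=
  (field_M0, field_M1, field_M2, field_g0, field_g1, field_g2).

(** What remains of the derivative of [M2] after removal of the rotation term [2 M1 M3]. It is real,
    hence common to the equations of [z1] and [z2]. *)
Definition sokolov_w p : C :=
  2 * c2%:C * (cg 1 p * cM 0 p - cg 0 p * cM 1 p) - 2 * c1%:C * cg 2 p.

Local Notation z1 := (@sokolov_z1 R).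
Local Notation z2 := (@sokolov_z2 R).
Local Notation e1 := (sokolov_e1 c1 c2).
Local Notation e2 := (sokolov_e2 c1 c2).

Lemma z1_dot p : is_cdirderive z1 p (V p) ('i%C * (2 * z1 p * cM 2 p + sokolov_w p)).
Proof.
rewrite sokolov_z1E; cderive; rewrite /sokolov_w /cM /cg !field_coordE.
by ring: (sqr_i R).
Qed.

Lemma z2_dot p : is_cdirderive z2 p (V p) (- 'i%C * (2 * z2 p * cM 2 p + sokolov_w p)).
Proof.
rewrite sokolov_z2E; cderive; rewrite /sokolov_w /cM /cg !field_coordE.
by ring: (sqr_i R).
Qed.

Lemma e1_dot p : is_cdirderive e1 p (V p) (4 * 'i%C * cM 2 p * e1 p).
Proof.
rewrite sokolov_e1E /ca; cderive; rewrite /cM /cg !field_coordE.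
by ring: (sqr_i R).
Qed.

Lemma e2_dot p : is_cdirderive e2 p (V p) (- 4 * 'i%C * cM 2 p * e2 p).
Proof.
rewrite sokolov_e2E /ca; cderive; rewrite /cM /cg !field_coordE.
by ring: (sqr_i R).
Qed.

(** An infinitesimal criterion for [first_integral], free of solutions and stable under sums and
    products. *)
Definition conserved (f : phase -> C) : Prop :=
  cpolyfun f /\ forall p, is_cdirderive f p (V p) 0.

Lemma conserved_first_integral f : conserved f -> first_integral V f.
Proof.
move=> [pf df]; split=> [p|D p [oD iD dp] t u Dt Du].
  exact: cpolyfun_cdifferentiable.
apply: (is_cderive0_eq (f := f \o p) iD) => // v Dv.
by apply: is_cderive_chain (df (p v)) (dp v Dv); apply: cpolyfun_cdifferentiable.
Qed.

Lemma conserved_cst c : conserved (fun=> c).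
Proof. by split=> [|p]; [exact: cpolyfun_cst | exact: is_cdirderive_cst]. Qed.

Lemma conservedD f g : conserved f -> conserved g -> conserved (fun p => f p + g p).
Proof.
move=> [pf df] [pg dg]; split=> [|p]; first exact: cpolyfunD.
by apply: is_cdirderive_eq (is_cdirderiveD (df p) (dg p)) _; rewrite addr0.
Qed.

Lemma conservedM f g : conserved f -> conserved g -> conserved (fun p => f p * g p).
Proof.
move=> [pf df] [pg dg]; split=> [|p]; first exact: cpolyfunM.
by apply: is_cdirderive_eq (is_cdirderiveM (df p) (dg p)) _; rewrite mulr0 mul0r addr0.
Qed.

Lemma conserved_cH : conserved (cH c1 c2).
Proof.
split=> [|p]; rewrite /cH; first by cpoly.
by cderive; rewrite /cM /cg !field_coordE; ring.
Qed.

Lemma conserved_ca : conserved (@ca R).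
Proof.
split=> [|p]; rewrite /ca; first by cpoly.
by cderive; rewrite /cM /cg !field_coordE; ring.
Qed.

Lemma conserved_cb : conserved (@cb R).
Proof.
split=> [|p]; rewrite /cb; first by cpoly.
by cderive; rewrite /cM /cg !field_coordE; ring.
Qed.

Lemma cpolyfun_z1 : cpolyfun z1.
Proof. by rewrite sokolov_z1E; cpoly. Qed.
Lemma cpolyfun_z2 : cpolyfun z2.
Proof. by rewrite sokolov_z2E; cpoly. Qed.
Lemma cpolyfun_e1 : cpolyfun e1.
Proof. by rewrite sokolov_e1E /ca; cpoly. Qed.
Lemma cpolyfun_e2 : cpolyfun e2.
Proof. by rewrite sokolov_e2E /ca; cpoly. Qed.

Lemma conserved_e12 : conserved (fun p => e1 p * e2 p).
Proof.
split=> [|p]; first by apply: cpolyfunM; [exact: cpolyfun_e1 | exact: cpolyfun_e2].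
by apply: is_cdirderive_eq (is_cdirderiveM (e1_dot p) (e2_dot p)) _; ring.
Qed.

Definition cbeta (p : phase) : C := - 4 * c1%:C * cb p.
Definition cdelta (p : phase) : C := - c2%:C ^+ 2 * ca p.
(** Given [h] and [b], this is the constant term of P that makes [f1_sqr] and [f2_sqr] hold. Squares
    of non-constant functions are written as products so that [conservedM] applies to them. *)
Definition cnu (p : phase) : C :=
  4 * c1%:C ^+ 2 * ca p - e1 p * e2 p
  + 2 * c2%:C ^+ 2 * (cH c1 c2 p * ca p - 2 * cb p * cb p) + c2%:C ^+ 4 * ca p * ca p.

Lemma conservedN f : conserved f -> conserved (fun p => - f p).
Proof.
move=> cf; rewrite (_ : (fun _ => _) = fun p => -1 * f p).
  by apply: conservedM => //; exact: conserved_cst.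
by apply/funext => p; rewrite mulN1r.
Qed.

Lemma conserved_cbeta : conserved cbeta.
Proof. by apply: conservedM; [exact: conserved_cst | exact: conserved_cb]. Qed.

Lemma conserved_cdelta : conserved cdelta.
Proof. by apply: conservedM; [exact: conserved_cst | exact: conserved_ca]. Qed.

Lemma conserved_cnu : conserved cnu.
Proof.
rewrite /cnu; repeat match goal with
  | |- conserved (fun q => sokolov_e1 _ _ q * sokolov_e2 _ _ q) =>
      exact: conserved_e12
  | |- conserved (fun q => @GRing.add _ _ _) => apply: conservedD
  | |- conserved (fun q => @GRing.opp _ _) => apply: conservedN
  | |- conserved (fun q => @GRing.mul _ _ _) => apply: conservedM
  | |- conserved (fun q => ?c) => exact: (conserved_cst c)
  | |- _ => first [exact: conserved_cH | exact: conserved_ca | exact: conserved_cb]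
  end.
Qed.

End SokolovField.

(** * The equations of the Kowalevski type *)

Section SokolovKowalevski.
Variables (R : realType) (c1 c2 : R).
Local Notation C := R[i].
Local Notation phase := (phase R).
Local Notation V := (sokolov_field c1 c2).
Local Notation z1 := (@sokolov_z1 R).
Local Notation z2 := (@sokolov_z2 R).
Local Notation e1 := (sokolov_e1 c1 c2).
Local Notation e2 := (sokolov_e2 c1 c2).
Local Notation h := (cH c1 c2).
Local Notation b := (cbeta c1).
Local Notation n := (cnu c1 c2).
Local Notation d := (cdelta c2).

Definition sokolov_F (p : phase) : triquadratic C := kowF (h p) (b p) (n p) (d p).
Definition sokolov_P (p : phase) : {poly C} := kowP (h p) (b p) (n p).
Definition sokolov_J (p : phase) : {poly C} := kowJ (h p) (b p) (n p) (d p).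

(** The signs of [f1] and [f2] are imposed by the equations of motion [z1' = - i f1] and
    [z2' = i f2]. *)
Definition sokolov_f1 p : C := - (2 * z1 p * cM 2 p + sokolov_w c1 c2 p).
Definition sokolov_f2 p : C := - (2 * z2 p * cM 2 p + sokolov_w c1 c2 p).
Local Notation f1 := sokolov_f1.
Local Notation f2 := sokolov_f2.

Let expandE := (sokolov_z1E, sokolov_z2E, sokolov_e1E, sokolov_e2E).

Lemma f1_sqr p : f1 p ^+ 2 = (sokolov_P p).[z1 p] + e1 p * (z1 p - z2 p) ^+ 2.
Proof.
rewrite /f1 kowPE /cnu /cbeta /cb /cH !expandE /ca /sokolov_w.
by ring: (sqr_i R).
Qed.

Lemma f2_sqr p : f2 p ^+ 2 = (sokolov_P p).[z2 p] + e2 p * (z1 p - z2 p) ^+ 2.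
Proof.
rewrite /f2 kowPE /cnu /cbeta /cb /cH !expandE /ca /sokolov_w.
by ring: (sqr_i R).
Qed.

(** The formulas for [f1^2] and [f2^2], the discriminant identity and [sokolov_relation] only give
    [(f1 f2)^2 = B^2 / 4]. This identity settles the sign, on which the cross term in [kow_abel]
    depends. *)
Lemma f1_f2 p : f1 p * f2 p =
  polar (h p) (b p) (n p) (z1 p) (z2 p) + d p * (z1 p - z2 p) ^+ 2.
Proof.
rewrite /f1 /f2 /polar /cnu /cbeta /cdelta /cb /cH !expandE /ca /sokolov_w.
by ring: (sqr_i R).
Qed.

Lemma sokolov_relation p : (sokolov_P p).[z2 p] * e1 p + (sokolov_P p).[z1 p] * e2 p =
  polC (sokolov_F p) (z1 p) (z2 p) - e1 p * e2 p * polA (sokolov_F p) (z1 p) (z2 p).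
Proof.
rewrite /sokolov_F kowAE kowCE !kowPE /kow_gap /polar.
rewrite /cnu /cbeta /cdelta /cb /cH !expandE /ca.
by ring: (sqr_i R).
Qed.

Lemma function_of_sokolov_constants T (G : C -> C -> C -> C -> T) :
  function_of_constants V (fun p => G (h p) (b p) (n p) (d p)).
Proof.
exists 4%N, (fun j : 'I_4 => nth (fun=> 0) [:: h; b; n; d] j).
exists (fun I => G (I 0) (I 1) (I 2) (I 3)); split=> //.
move=> [[|[|[|[|//]]]] ?] /=; apply: conserved_first_integral.
- exact: conserved_cH.
- exact: conserved_cbeta.
- exact: conserved_cnu.
- exact: conserved_cdelta.
Qed.

Lemma is_cderive_sokolov (f : phase -> C) D (p : R -> phase) t l : cpolyfun f ->
  solution V D p -> D t -> is_cdirderive f (p t) (V (p t)) l ->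
  is_cderive (f \o p) t l.
Proof.
move=> pf [_ _ dp] Dt fl; apply: is_cderive_chain fl (dp t Dt).
exact: cpolyfun_cdifferentiable.
Qed.

Lemma sokolov_kowalevski : kowalevski_equations V z1 z2 e1 e2 sokolov_F sokolov_P sokolov_J.
Proof.
split.
- split.
  + exact: (function_of_sokolov_constants (@kowF _)).
  + exact: (function_of_sokolov_constants (fun h b n _ => kowP h b n)).
  + exact: (function_of_sokolov_constants (@kowJ _)).
- by move=> p; exact: kow_discriminantly_separable.
(* Since [e1' = 4 i M3 e1], halving the rate gives [m = - 2 i M3]. *)
- exists 2^-1, (fun p => - 2 * 'i%C * cM 2 p), f1, f2; split.
  + by rewrite invr_eq0 pnatr_eq0.
  + move=> D p sol t Dt.
    exists ('i%C * (2 * z1 (p t) * cM 2 (p t) + sokolov_w c1 c2 (p t))).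
    exists (- 'i%C * (2 * z2 (p t) * cM 2 (p t) + sokolov_w c1 c2 (p t))).
    exists (4 * 'i%C * cM 2 (p t) * e1 (p t)), (- 4 * 'i%C * cM 2 (p t) * e2 (p t)).
    have kE : (2^-1)%:C = 2^-1 :> C by rewrite fmorphV rmorph_nat.
    split; rewrite ?kE.
    * split; apply: is_cderive_sokolov sol Dt _.
      - exact: cpolyfun_z1.
      - exact: z1_dot.
      - exact: cpolyfun_z2.
      - exact: z2_dot.
    * split; apply: is_cderive_sokolov sol Dt _.
      - exact: cpolyfun_e1.
      - exact: e1_dot.
      - exact: cpolyfun_e2.
      - exact: e2_dot.
    * by rewrite /f1 /f2; split; field.
    * by field.
    * by field.
  + by move=> p; rewrite kowAE f1_sqr.
  + by move=> p; rewrite kowAE f2_sqr.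
- exact: sokolov_relation.
Qed.

End SokolovKowalevski.

(** * The Abel equations *)

Section Cderivable.
Context {R : realType}.
Local Notation C := R[i].

(** Bare existence suffices for the roots at first, since implicit differentiation determines the
    value afterwards. *)
Definition cderivable (f : R -> C) (t : R) : Prop := exists l, is_cderive f t l.

Lemma cderivable_cst c t : cderivable (fun=> c) t.
Proof. by exists 0; exact: is_cdirderive_cst. Qed.
Lemma cderivableD f g t :
  cderivable f t -> cderivable g t -> cderivable (fun u => f u + g u) t.
Proof. by move=> [l fl] [m gm]; exists (l + m); exact: is_cdirderiveD. Qed.
Lemma cderivableN f t : cderivable f t -> cderivable (fun u => - f u) t.
Proof. by move=> [l fl]; exists (- l); exact: is_cdirderiveN. Qed.
Lemma cderivableM f g t :
  cderivable f t -> cderivable g t -> cderivable (fun u => f u * g u) t.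
Proof. by move=> [l fl] [m gm]; eexists; exact: is_cdirderiveM fl gm. Qed.
Lemma cderivableX f k t : cderivable f t -> cderivable (fun u => f u ^+ k) t.
Proof. by move=> [l fl]; eexists; exact: is_cdirderiveX fl. Qed.
Lemma cderivableV f t : f t != 0 -> cderivable f t -> cderivable (fun u => (f u)^-1) t.
Proof. by move=> f0 [l fl]; exact: is_cderiveV fl. Qed.

End Cderivable.

Ltac cderivable_step := first [eassumption | match goal with
  | |- cderivable (fun q => ?c) _ => exact: (cderivable_cst c)
  | |- cderivable (fun q => @GRing.add _ _ _) _ => apply: cderivableD
  | |- cderivable (fun q => @GRing.opp _ _) _ => apply: cderivableN
  | |- cderivable (fun q => @GRing.exp _ _ _) _ => apply: cderivableX
  | |- cderivable (fun q => @GRing.mul _ _ _) _ => apply: cderivableM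
  | |- cderivable (fun q => @GRing.inv _ _) _ => apply: cderivableV
  end].

Section SokolovAbel.
Variables (R : realType) (c1 c2 : R).
Local Notation C := R[i].
Local Notation phase := (phase R).
Local Notation V := (sokolov_field c1 c2).
Local Notation z1 := (@sokolov_z1 R).
Local Notation z2 := (@sokolov_z2 R).
Local Notation e1 := (sokolov_e1 c1 c2).
Local Notation e2 := (sokolov_e2 c1 c2).
Local Notation h := (cH c1 c2).
Local Notation b := (cbeta c1).
Local Notation n := (cnu c1 c2).
Local Notation d := (cdelta c2).
Local Notation F := (sokolov_F c1 c2).
Local Notation J := (sokolov_J c1 c2).
Local Notation f1 := (sokolov_f1 c1 c2).
Local Notation f2 := (sokolov_f2 c1 c2).

Lemma cderivable_cpolyfun (f : phase -> C) D (p : R -> phase) t : cpolyfun f ->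
  solution V D p -> D t -> cderivable (fun u => f (p u)) t.
Proof.
move=> pf sol Dt; exists (cdirderiv f (p t) (V (p t))).
apply: is_cderive_sokolov sol Dt _ => //.
case: pf => [[d1 _] [d2 _]]; split; apply/derivableP/diff_derivable; first exact: d1.
exact: d2.
Qed.

Lemma ccontinuous_atB (f g : R -> C) t : ccontinuous_at f t -> ccontinuous_at g t ->
  ccontinuous_at (fun u => f u - g u) t.
Proof.
move=> [f1 f2] [g1 g2]; split.
  rewrite (_ : (fun _ => _) = fun u => complex.Re (f u) - complex.Re (g u)).
    exact: cvgB.
  by apply/funext => u; rewrite ReD ReN.
rewrite (_ : (fun _ => _) = fun u => complex.Im (f u) - complex.Im (g u)).
  exact: cvgB.
by apply/funext => u; rewrite ImD ImN.
Qed.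

Lemma curve_polyE (lambda k x : C) (Q : {poly C}) :
  (curve_poly lambda Q k).[x] = lambda * (Q.[x] * ((x - k) * (x + k))).
Proof. by rewrite /curve_poly !hornerE /=; ring. Qed.

Lemma vieta (A B D r s : C) : A != 0 ->
  (forall x, A * x ^+ 2 + B * x + D = A * (x - r) * (x - s)) ->
  B = - A * (r + s) /\ D = A * r * s.
Proof.
move=> A0 fact; have DE : D = A * r * s.
  by have := fact 0; rewrite expr0n mulr0 mulr0 !add0r => ->; ring.
split=> //; have := fact 1.
rewrite DE expr1n !mulr1 => E; have -> : B = A + B + A * r * s - A - A * r * s by ring.
by rewrite E; ring.
Qed.

(** * Motion of one root [r] of F along a solution, [s] being the other root *)

Section Branch.
Variables (D : set R) (p : R -> phase) (k : C) (r s : R -> C).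
Hypothesis sol : solution V D p.
Hypothesis kE : forall t, D t -> k ^+ 2 = e1 (p t) * e2 (p t).
Hypothesis A0 : forall t, D t -> polA (F (p t)) (z1 (p t)) (z2 (p t)) != 0.
Hypothesis fact : forall t, D t -> forall x,
  eval3 (F (p t)) (z1 (p t)) (z2 (p t)) x =
  polA (F (p t)) (z1 (p t)) (z2 (p t)) * (x - r t) * (x - s t).
Hypothesis cont : forall t, D t -> ccontinuous_at r t /\ ccontinuous_at s t.
Hypothesis rs : forall t, D t -> r t != s t.

Let x1 u := z1 (p u).
Let x2 u := z2 (p u).
(** [A], [B] and, further on, [E] are the coefficients of [s^2], [s] and 1 in F along the motion, in
    a form to which the differentiation rules apply. *)
Let A u := (x1 u - x2 u) ^+ 2.
Let B u := 2 * (polar (h (p u)) (b (p u)) (n (p u)) (x1 u) (x2 u) + d (p u) * A u).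

Let dpoly f t : D t -> cpolyfun f -> cderivable (fun u => f (p u)) t.
Proof. by move=> Dt pf; exact: cderivable_cpolyfun sol Dt. Qed.

Let dx1 t : D t -> cderivable x1 t.
Proof. by move=> Dt; exact: (dpoly Dt (@cpolyfun_z1 R)). Qed.
Let dx2 t : D t -> cderivable x2 t.
Proof. by move=> Dt; exact: (dpoly Dt (@cpolyfun_z2 R)). Qed.
Let dh t : D t -> cderivable (fun u => h (p u)) t.
Proof. by move=> Dt; exact: (dpoly Dt (proj1 (conserved_cH c1 c2))). Qed.
Let db t : D t -> cderivable (fun u => b (p u)) t.
Proof. by move=> Dt; exact: (dpoly Dt (proj1 (conserved_cbeta c1 c2))). Qed.
Let dn t : D t -> cderivable (fun u => n (p u)) t.
Proof. by move=> Dt; exact: (dpoly Dt (proj1 (conserved_cnu c1 c2))). Qed.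
Let dd t : D t -> cderivable (fun u => d (p u)) t.
Proof. by move=> Dt; exact: (dpoly Dt (proj1 (conserved_cdelta c1 c2))). Qed.

Let nearD t : D t -> \forall u \near t, D u.
Proof. by move=> Dt; case: sol => oD _ _; apply: open_nbhs_nbhs. Qed.

Let AE u : polA (F (p u)) (x1 u) (x2 u) = A u.
Proof. exact: kowAE. Qed.

Let dA t : D t -> cderivable A t.
Proof.
by move=> Dt; have := dx1 Dt; have := dx2 Dt => ? ?; rewrite /A; repeat cderivable_step.
Qed.

Let An0 t : D t -> A t != 0.
Proof. by move=> /A0; rewrite AE. Qed.

Let E u := kow_gap (h (p u)) (b (p u)) (n (p u)) (x1 u) (x2 u)
  + 2 * d (p u) * polar (h (p u)) (b (p u)) (n (p u)) (x1 u) (x2 u)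
  + d (p u) ^+ 2 * A u.

Let vietaD t : D t -> B t = - A t * (r t + s t) /\ E t = A t * r t * s t.
Proof.
move=> Dt; apply: vieta => [|x]; first exact: An0.
by have := fact Dt x; rewrite /eval3 /sokolov_F kowAE kowBE kowCE.
Qed.

Lemma cderivable_branch t : D t -> cderivable r t.
Proof.
move=> Dt; have [cr cs] := cont Dt.
have [h0 h1 h2 h3] := And4 (dx1 Dt) (dx2 Dt) (dh Dt) (db Dt).
have [h4 h5 h6] := And3 (dn Dt) (dd Dt) (dA Dt).
have h7 := An0 Dt.
have dB : cderivable B t by rewrite /B /polar; repeat cderivable_step.
have dE : cderivable E t by rewrite /E /kow_gap /polar; repeat cderivable_step.
have d0 : r t - s t != 0 by rewrite subr_eq0 rs.
(* The discriminant divided by [A^2], equal on [D] to [(r - s)^2] by Vieta. *)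
have [l dl] : cderivable (fun u => (B u / A u) ^+ 2 - 4 * (E u / A u)) t.
  by repeat cderivable_step.
have dd' : cderivable (fun u => r u - s u) t.
  eexists; apply: is_cderive_sqrt (ccontinuous_atB cr cs) d0 dl.
  apply: filterS (nearD Dt) => u Du; have [-> ->] := vietaD Du.
  by have := An0 Du => A0'; field.
(* The root is half the sum of the difference [r - s] and of [r + s = - B / A]. *)
have [m dm] : cderivable (fun u => 2^-1 * ((r u - s u) - B u / A u)) t.
  by repeat cderivable_step.
exists m; apply: near_is_cderive dm.
apply: filterS (nearD Dt) => u Du; have [-> _] := vietaD Du.
by have := An0 Du => A0'; field.
Qed.

(** The numerator is [- (F_x x1' + F_y x2')], because [x1' = - i f1] and [x2' = i f2]. [W] serves as
    the branch of the square root of Phi at [r]. *)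
Let W u := 'i%C * (kow_dx (h (p u)) (b (p u)) (n (p u)) (d (p u)) (x1 u) (x2 u) (r u) * f1 (p u)
  - kow_dx (h (p u)) (b (p u)) (n (p u)) (d (p u)) (x2 u) (x1 u) (r u) * f2 (p u)) / A u.

(** Implicit differentiation of F(x1, x2, r) = 0, where [F_s = 2 A r + B = A (r - s)] by Vieta. *)
Lemma is_cderive_branch t : D t -> is_cderive r t (W t / (r t - s t)).
Proof.
move=> Dt; have [l dl] := cderivable_branch Dt.
have A1 := An0 Dt; have d0 : r t - s t != 0 by rewrite subr_eq0 rs.
suff E0 : A t * (r t - s t) * l = A t * W t.
  have -> : W t / (r t - s t) = l => //.
  apply: (mulfI A1); apply: (mulIf d0); rewrite mulrA mulfVK// -E0; ring.
have e1' : is_cdirderive (x1 : R^o -> C) t 1 (- 'i%C * f1 (p t)).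
  apply: is_cdirderive_eq (is_cderive_sokolov (@cpolyfun_z1 R) sol Dt (@z1_dot R c1 c2 _)) _.
  by rewrite /sokolov_f1 mulrNN.
have e2' : is_cdirderive (x2 : R^o -> C) t 1 ('i%C * f2 (p t)).
  apply: is_cdirderive_eq (is_cderive_sokolov (@cpolyfun_z2 R) sol Dt (@z2_dot R c1 c2 _)) _.
  by rewrite /sokolov_f2 mulrN mulNr.
have r' : is_cdirderive (r : R^o -> C) t 1 l by [].
(* F along the motion with its parameters frozen at time [t]. These being constants of motion, [Q]
   still vanishes near [t]; comparing its zero derivative with the one computed by the rules yields
   the equation for [l]. *)
pose Q u := (x1 u - x2 u) ^+ 2 * r u ^+ 2
  + 2 * (polar (h (p t)) (b (p t)) (n (p t)) (x1 u) (x2 u) + d (p t) * (x1 u - x2 u) ^+ 2) * r u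
  + (kow_gap (h (p t)) (b (p t)) (n (p t)) (x1 u) (x2 u)
     + 2 * d (p t) * polar (h (p t)) (b (p t)) (n (p t)) (x1 u) (x2 u)
     + d (p t) ^+ 2 * (x1 u - x2 u) ^+ 2).
have Q0 : is_cderive Q t 0.
  apply: (@near_is_cderive _ (fun=> 0)); last exact: is_cdirderive_cst.
  apply: filterS (nearD Dt) => u Du.
  have := fact Du (r u).
  rewrite /eval3 /sokolov_F kowAE kowBE kowCE subrr mulr0 mul0r => <-.
  rewrite /Q; have cst f : conserved c1 c2 f -> f (p u) = f (p t).
    by move=> /conserved_first_integral [_]; apply; [exact: sol | |].
  by rewrite (cst _ (conserved_cH _ _)) (cst _ (conserved_cbeta _ _))
    (cst _ (conserved_cnu _ _)) (cst _ (conserved_cdelta _ _)).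
have Q1 : is_cdirderive (Q : R^o -> C) t 1
   (A t * (r t - s t) * l - A t * W t).
  rewrite /Q /polar /kow_gap; cderive.
  have -> : A t * W t = 'i%C * (kow_dx (h (p t)) (b (p t)) (n (p t)) (d (p t)) (x1 t) (x2 t) (r t) * f1 (p t)
  - kow_dx (h (p t)) (b (p t)) (n (p t)) (d (p t)) (x2 t) (x1 t) (r t) * f2 (p t)).
    by rewrite /W mulrC divfK.
  have -> : A t * (r t - s t) * l = (2 * A t * r t + B t) * l.
    by have [-> _] := vietaD Dt; ring.
  by rewrite /= /kow_dx /B /A /polar; ring.
by apply/eqP; rewrite -subr_eq0; apply/eqP; exact: is_cdirderive_unique Q1 Q0.
Qed.

(** [kow_abel] gives [4 A^2 J(r) (r^2 - k^2)] for the square of the bracket in [W]; the factor [i]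
    supplies the minus sign and the denominator removes [A^2]. *)
Lemma branch_sqr t : D t -> W t ^+ 2 = (curve_poly (- 4) (J (p t)) k).[r t].
Proof.
move=> Dt; have A1 := An0 Dt.
rewrite curve_polyE.
have F0 : eval3 (F (p t)) (x1 t) (x2 t) (r t) = 0.
  by rewrite fact// subrr mulr0 mul0r.
have := kow_abel (f1_sqr c1 c2 (p t)) (f2_sqr c1 c2 (p t)) (f1_f2 c1 c2 (p t)) (kE Dt)
  (sokolov_relation c1 c2 (p t)) F0.
rewrite /W expr_div_n exprMn sqr_i => -> .
rewrite /A /x1 /x2 in A1 *; rewrite -/(J (p t)).
move: (J (p t)).[r t] => Jr; field.
by move: A1; rewrite expf_eq0.
Qed.

Lemma branch_continuous t : D t -> ccontinuous_at W t.
Proof.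
move=> Dt; suff [l] : cderivable W t by exact: is_cderive_continuous.
have [h0 h1 h2 h3] := And4 (dx1 Dt) (dx2 Dt) (dh Dt) (db Dt).
have [h4 h5 h6 h7] := And4 (dn Dt) (dd Dt) (dA Dt) (cderivable_branch Dt).
have h8 := An0 Dt.
have h9 : cderivable (fun u => f1 (p u)) t.
  by apply: (dpoly Dt); rewrite /sokolov_f1 /sokolov_w sokolov_z1E; cpoly.
have h10 : cderivable (fun u => f2 (p u)) t.
  by apply: (dpoly Dt); rewrite /sokolov_f2 /sokolov_w sokolov_z2E; cpoly.
by rewrite /W /kow_dx; repeat cderivable_step.
Qed.

Lemma abel_branch : exists w : R -> C, forall t, D t ->
  [/\ is_cderive r t (w t / (r t - s t)), ccontinuous_at w t &
      w t ^+ 2 = (curve_poly (- 4) (J (p t)) k).[r t]].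
Proof.
by exists W => t Dt; split;
  [exact: is_cderive_branch | exact: branch_continuous | exact: branch_sqr].
Qed.

End Branch.

Lemma sokolov_abel : abel_equations V z1 z2 e1 e2 F J (- 4) 1.
Proof.
split; rewrite ?oppr_eq0 ?pnatr_eq0 ?oner_eq0//.
  exact/conserved_first_integral/conserved_e12.
move=> D p k s1 s2 sol Phi hyp.
have kE t : D t -> k ^+ 2 = e1 (p t) * e2 (p t) by move=> /hyp [].
have A0 t : D t -> polA (F (p t)) (z1 (p t)) (z2 (p t)) != 0 by move=> /hyp [].
have fact t : D t -> forall x, eval3 (F (p t)) (z1 (p t)) (z2 (p t)) x =
  polA (F (p t)) (z1 (p t)) (z2 (p t)) * (x - s1 t) * (x - s2 t) by move=> /hyp [].
have cont t : D t -> ccontinuous_at s1 t /\ ccontinuous_at s2 t by move=> /hyp [].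
have rs t : D t -> s1 t != s2 t by move=> /hyp [_ _ _ _ []].
have [w1 w1E] := abel_branch sol kE A0 fact cont rs.
have [w2 w2E] : exists w : R -> C, forall t, D t ->
  [/\ is_cderive s2 t (w t / (s2 t - s1 t)), ccontinuous_at w t &
      w t ^+ 2 = (curve_poly (- 4) (J (p t)) k).[s2 t]].
  (* The same result with the two roots exchanged. *)
  apply: (abel_branch sol kE A0) => t Dt.
  - by move=> x; rewrite fact// mulrAC.
  - by have [] := cont t Dt.
  - by rewrite eq_sym rs.
(* With these derivatives the Abel equations become [1/(s1 - s2) + 1/(s2 - s1) = 0] and
   [s1/(s1 - s2) + s2/(s2 - s1) = 1], whence [c = 1]. Division by [w1] and [w2] is legitimate away
   from ramification points. *)
exists (fun t => w1 t / (s1 t - s2 t)), (fun t => w2 t / (s2 t - s1 t)), w1, w2 => t Dt.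
have [s1' w1c w1s] := w1E t Dt; have [s2' w2c w2s] := w2E t Dt.
have [_ _ _ _ [s12 P1 P2]] := hyp t Dt.
have w10 : w1 t != 0 by apply: contraNneq P1 => w0; rewrite /Phi -w1s w0 expr0n.
have w20 : w2 t != 0 by apply: contraNneq P2 => w0; rewrite /Phi -w2s w0 expr0n.
have d0 : s1 t - s2 t != 0 by rewrite subr_eq0.
have d1 : s2 t - s1 t != 0 by rewrite subr_eq0 eq_sym.
split=> //.
  by field; rewrite d0 d1 w10 w20.
by field; rewrite d0 d1 w10 w20.
Qed.

End SokolovAbel.

(** * Genericity *)

Section SokolovGeneric.
Variables (R : realType) (c1 c2 : R).
Local Notation C := R[i].
Local Notation phase := (phase R).
Local Notation z1 := (@sokolov_z1 R).
Local Notation z2 := (@sokolov_z2 R).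
Local Notation e1 := (sokolov_e1 c1 c2).
Local Notation e2 := (sokolov_e2 c1 c2).
Local Notation h := (cH c1 c2).
Local Notation b := (cbeta c1).
Local Notation n := (cnu c1 c2).
Local Notation d := (cdelta c2).
Local Notation J := (sokolov_J c1 c2).

Definition phase_point (m0 m1 m2 g0 g1 g2 : R) : phase :=
  (\row_i nth 0 [:: m0; m1; m2] i, \row_i nth 0 [:: g0; g1; g2] i).

Lemma cM_point m0 m1 m2 g0 g1 g2 i :
  cM i (phase_point m0 m1 m2 g0 g1 g2) = (nth 0 [:: m0; m1; m2] i)%:C.
Proof. by rewrite /cM /Mc mxE. Qed.
Lemma cg_point m0 m1 m2 g0 g1 g2 i :
  cg i (phase_point m0 m1 m2 g0 g1 g2) = (nth 0 [:: g0; g1; g2] i)%:C.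
Proof. by rewrite /cg /gc mxE. Qed.

Let pointE := (cM_point, cg_point).

Lemma real_neq0 (x : R) : x != 0 -> x%:C != 0 :> C.
Proof. by rewrite fmorph_eq0. Qed.

(** Up to the factor [- 8 i], the determinant of the derivatives of [e1] and [e2] with respect to
    the first two components of gamma. It is identically zero for [c1 = c2 = 0], when [e1 = z1^2]
    and [e2 = z2^2]. *)
Definition coord_minor (p : phase) : C :=
  c2%:C ^+ 2 * cM 2 p ^+ 2 + c2%:C ^+ 3 * cg 1 p * cM 2 p + c1%:C ^+ 2
  + c1%:C * c2%:C ^+ 2 * cg 0 p.

Lemma sqr_sum_neq0 : (c1 != 0) || (c2 != 0) -> c1 ^+ 2 + c2 ^+ 2 != 0.
Proof. by rewrite paddr_eq0 ?sqr_ge0// !sqrf_eq0 negb_and. Qed.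

Lemma coord_minor_generic : (c1 != 0) || (c2 != 0) ->
  generically (fun p => coord_minor p != 0).
Proof.
move=> c0; apply: (@cpolyfun_generically _ _ (phase_point 0 0 1 0 0 0)).
  by rewrite /coord_minor; cpoly.
have -> : coord_minor (phase_point 0 0 1 0 0 0) = (c1 ^+ 2 + c2 ^+ 2)%:C.
  by rewrite /coord_minor !pointE /=; ring.
exact/real_neq0/sqr_sum_neq0.
Qed.

Lemma e12_generic : (c1 != 0) || (c2 != 0) ->
  generically (fun p => e1 p * e2 p != 0).
Proof.
move=> c0; apply: (@cpolyfun_generically _ _ (phase_point 0 0 1 1 0 0)).
  exact: (proj1 (conserved_e12 c1 c2)).
have -> : e1 (phase_point 0 0 1 1 0 0) * e2 (phase_point 0 0 1 1 0 0) =
    ((2 * c1 + c2 ^+ 2) ^+ 2 + (2 * c2) ^+ 2)%:C.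
  by rewrite sokolov_e1E sokolov_e2E /ca !pointE /=; ring: (sqr_i R).
apply: real_neq0; rewrite paddr_eq0 ?sqr_ge0// !sqrf_eq0 negb_and.
have [c20|c20] := eqVneq c2 0; last by rewrite orbC mulf_neq0// pnatr_eq0.
by move: c0; rewrite c20 eqxx orbF => c10; rewrite expr0n addr0 mulf_neq0// pnatr_eq0.
Qed.

Lemma kow_disc_generic : (c1 != 0) || (c2 != 0) ->
  generically (fun p => kow_disc (h p) (b p) (n p) != 0).
Proof.
move=> c0.
have [p0 p0E] : exists p, kow_disc (h p) (b p) (n p) != 0.
  (* Each case has its own sample point, at which the discriminant collapses to a multiple of a
     single power of [c1] or of [c2]. *)
  have [c10|c10] := eqVneq c1 0; last first.
    exists (phase_point 0 0 0 0 0 1).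
    set D := kow_disc _ _ _; have -> : D = (9216 * c1 ^+ 6)%:C.
      rewrite /D /kow_disc /cnu /cbeta /cb /cH sokolov_e1E sokolov_e2E /ca !pointE /=.
      by ring: (sqr_i R).
    by apply: real_neq0; rewrite mulf_neq0 ?pnatr_eq0// expf_neq0.
  have c20 : c2 != 0 by move: c0; rewrite c10 eqxx.
  exists (phase_point c2 0 0 0 1 0).
  set D := kow_disc _ _ _; have -> : D = (6912 * c2 ^+ 12)%:C.
    rewrite /D /kow_disc /cnu /cbeta /cb /cH sokolov_e1E sokolov_e2E /ca !pointE c10 /=.
    by ring: (sqr_i R).
  by apply: real_neq0; rewrite mulf_neq0 ?pnatr_eq0// expf_neq0.
apply: cpolyfun_generically p0E.
have [hh hb hn] := And3 (proj1 (conserved_cH c1 c2)) (proj1 (conserved_cbeta c1 c2))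
  (proj1 (conserved_cnu c1 c2)).
by rewrite /kow_disc; cpoly.
Qed.

(** [J(k) J(- k)] in terms of [kappa = k^2]: the square of the even part of J minus [kappa] times
    that of the odd part divided by [k]. Since [k^2 = e1 e2], this is a polynomial function on the
    phase space, whereas [k] is only a square root of one. *)
Definition kow_pm (h b n d kappa : C) : C :=
  ((2 * h - 6 * d) * kappa + (2 * (h - d) * (d ^+ 2 + n) - b ^+ 2)) ^+ 2
  - kappa * (4 * d * h - 6 * d ^+ 2 - 2 * n - 2 * kappa) ^+ 2.

Lemma kowJ_pm (h b n d k : C) :
  (kowJ h b n d).[k] * (kowJ h b n d).[- k] = kow_pm h b n d (k ^+ 2).
Proof. by rewrite !kowJE /kow_pm; ring. Qed.

Lemma kow_pm_generic : (c1 != 0) || (c2 != 0) ->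
  generically (fun p => kow_pm (h p) (b p) (n p) (d p) (e1 p * e2 p) != 0).
Proof.
move=> c0.
(* A value of [M3] large enough that, at the sample point, [m^2 + 2 c1] and the quadratic expression
   in [c1] are both nonzero whatever the constants. *)
pose m := 1 + c1 ^+ 2 + c2 ^+ 2.
apply: (@cpolyfun_generically _ _ (phase_point 0 0 m 1 0 0)).
  have [hh hb hn hd] := And4 (proj1 (conserved_cH c1 c2)) (proj1 (conserved_cbeta c1 c2))
    (proj1 (conserved_cnu c1 c2)) (proj1 (conserved_cdelta c1 c2)).
  have [h1 h2] := conj (@cpolyfun_e1 R c1 c2) (@cpolyfun_e2 R c1 c2).
  by rewrite /kow_pm; cpoly.
set D := kow_pm _ _ _ _ _.
have -> : D = (256 * (m ^+ 2 * (m ^+ 2 + 2 * c1)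
    * (c1 ^+ 2 + c1 * c2 ^+ 2 + c2 ^+ 2 * m ^+ 2) ^+ 2))%:C.
  rewrite /D /kow_pm /cnu /cbeta /cdelta /cb /cH sokolov_e1E sokolov_e2E /ca !pointE /=.
  by ring: (sqr_i R).
have c12 := sqr_sum_neq0 c0.
have m1 : 1 <= m by rewrite /m; have := sqr_ge0 c1; have := sqr_ge0 c2; lra.
have m0 : m != 0 by rewrite lt0r_neq0// (lt_le_trans ltr01).
have mc1 : m ^+ 2 + 2 * c1 != 0.
  rewrite lt0r_neq0// /m; have := sqr_ge0 (c1 ^+ 2 + c2 ^+ 2).
  have := sqr_ge0 c2; have := sqr_ge0 (1 + c1).
  have : 0 < 1 + 2 * c1 + 2 * c1 ^+ 2 :> R by have := sqr_ge0 (1 + 2 * c1); nra.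
  nra.
have mc2 : c1 ^+ 2 + c1 * c2 ^+ 2 + c2 ^+ 2 * m ^+ 2 != 0.
  have [c20|c20] := eqVneq c2 0.
    by move: c12; rewrite c20 expr0n /= mulr0 mul0r !addr0.
  (* Completing the square in [c1] leaves a term that is positive because [m^2] exceeds
     [c2^2 / 4]. *)
  have -> : c1 ^+ 2 + c1 * c2 ^+ 2 + c2 ^+ 2 * m ^+ 2 =
    (c1 + c2 ^+ 2 / 2) ^+ 2 + c2 ^+ 2 * (m ^+ 2 - c2 ^+ 2 / 4) by field.
  rewrite lt0r_neq0// ltr_wpDl ?sqr_ge0// mulr_gt0//.
    by rewrite lt_neqAle sqr_ge0 andbT eq_sym sqrf_eq0.
  have := sqr_ge0 c1; have := sqr_ge0 c2; rewrite /m in m1 *; nra.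
apply: real_neq0; rewrite mulf_neq0 ?pnatr_eq0//.
by apply: mulf_neq0; [apply: mulf_neq0 => //; rewrite expf_neq0 | rewrite expf_neq0].
Qed.

Lemma genus_two_generic : (c1 != 0) || (c2 != 0) ->
  generically (fun p : phase => forall k : C,
    k ^+ 2 = e1 p * e2 p -> genus_two (curve_poly (- 4) (J p) k)).
Proof.
move=> c0; apply: generically_sub (generically_and (e12_generic c0)
  (generically_and (kow_disc_generic c0) (kow_pm_generic c0))).
move=> p [e0 [D0 E0]] k kE; apply: genus_two_cubic.
- exact: size_kowJ.
- exact: kowJ_separable.
- by rewrite oppr_eq0 pnatr_eq0.
- by move: e0; rewrite -kE expf_eq0.
- by rewrite kowJ_pm kE.
Qed.

Lemma is_cdirderive_e1 (p v : phase) : is_cdirderive e1 p v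
  (2 * z1 p * (cM 0 v + 'i%C * cM 1 v) - 2 * c1%:C * (cg 0 v + 'i%C * cg 1 v)
   - 2 * c2%:C ^+ 2 * (cg 0 p * cg 0 v + cg 1 p * cg 1 v + cg 2 p * cg 2 v)
   - 2 * c2%:C * (cg 1 v * cM 2 p + cg 1 p * cM 2 v - cg 2 v * cM 1 p - cg 2 p * cM 1 v
     + 'i%C * (cg 2 v * cM 0 p + cg 2 p * cM 0 v - cg 0 v * cM 2 p - cg 0 p * cM 2 v))).
Proof. by rewrite sokolov_e1E sokolov_z1E /ca; cderive; rewrite /=; ring. Qed.

Lemma is_cdirderive_e2 (p v : phase) : is_cdirderive e2 p v
  (2 * z2 p * (cM 0 v - 'i%C * cM 1 v) - 2 * c1%:C * (cg 0 v - 'i%C * cg 1 v)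
   - 2 * c2%:C ^+ 2 * (cg 0 p * cg 0 v + cg 1 p * cg 1 v + cg 2 p * cg 2 v)
   - 2 * c2%:C * (cg 1 v * cM 2 p + cg 1 p * cM 2 v - cg 2 v * cM 1 p - cg 2 p * cM 1 v
     - 'i%C * (cg 2 v * cM 0 p + cg 2 p * cM 0 v - cg 0 v * cM 2 p - cg 0 p * cM 2 v))).
Proof. by rewrite sokolov_e2E sokolov_z2E /ca; cderive; rewrite /=; ring. Qed.

Lemma is_cdirderive_z1 (p v : phase) :
  is_cdirderive z1 p v (cM 0 v + 'i%C * cM 1 v).
Proof. by rewrite sokolov_z1E; cderive; rewrite /=; ring. Qed.

Lemma is_cdirderive_z2 (p v : phase) :
  is_cdirderive z2 p v (cM 0 v - 'i%C * cM 1 v).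
Proof. by rewrite sokolov_z2E; cderive; rewrite /=; ring. Qed.

Let dirE := (cM_eM, cM_eg, cg_eM, cg_eg).

(** A tangent vector killed by all six differentials is shown to be zero. [M3] and [g3] remove their
    own components, [z1] and [z2] those along [M1] and [M2]; what is left is a 2 by 2 system from
    [e1] and [e2], with determinant [- 8 i coord_minor]. *)
Lemma coordinates_generic : (c1 != 0) || (c2 != 0) ->
  generically (coordinates_at z1 z2 e1 e2 (Mc 2) (gc 2)).
Proof.
move=> c0; apply: generically_sub (coord_minor_generic c0) => p minor0.
split.
  have pM := cpolyfun_cM (R := R); have pg := cpolyfun_cg (R := R).
  move=> i; apply: cpolyfun_cdifferentiable; move: i.
  case=> [[|[|[|[|[|[|//]]]]]] ?].
  - exact: cpolyfun_z1.
  - exact: cpolyfun_z2.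
  - exact: cpolyfun_e1.
  - exact: cpolyfun_e2.
  - exact: pM.
  - exact: pg.
set y := [tuple _; _; _; _; _; _].
rewrite -unitmx_tr -row_free_unit; apply: inj_row_free => v v0.
pose a k := v 0 (lshift 3 k); pose c k := v 0 (rshift 3 k).
(* Row [i] of the Jacobian applied to the vector with components [a] along M and [c] along gamma. *)
have key i (l : phase -> C) : (forall w, is_cdirderive (tnth y i) p w (l w)) ->
    a 0 * l (eM R 0) + a 1 * l (eM R 1) + a 2 * l (eM R 2)
    + (c 0 * l (eg R 0) + c 1 * l (eg R 1) + c 2 * l (eg R 2)) = 0.
  move=> yl; have := congr1 (fun w : 'rV_(3 + 3) => w 0 i) v0.
  rewrite !mxE big_split_ord /= !big_ord3 !mxE.
  rewrite !(unsplitK (inl _)) !(unsplitK (inr _)).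
  by rewrite !(is_cdirderive_cdirderiv (yl _)).
have k4 := key (@Ordinal (3 + 3) 4 isT) (cM 2) (is_cdirderive_cM 2 p).
have k5 := key (@Ordinal (3 + 3) 5 isT) (cg 2) (is_cdirderive_cg 2 p).
have k0 := key (@Ordinal (3 + 3) 0 isT) _ (is_cdirderive_z1 p).
have k1 := key (@Ordinal (3 + 3) 1 isT) _ (is_cdirderive_z2 p).
have k2 := key (@Ordinal (3 + 3) 2 isT) _ (is_cdirderive_e1 p).
have k3 := key (@Ordinal (3 + 3) 3 isT) _ (is_cdirderive_e2 p).
rewrite !dirE /= !(mulr0, mulr1, addr0, add0r) in k4 k5.
rewrite !dirE /= k4 k5 !(mulr0, mul0r, mulr1, addr0, add0r, subr0, sub0r) in k0 k1.
have a0 : a 0 = 0.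
  have : 2 * a 0 = 0 by transitivity (0 + 0 : C); [rewrite -{1}k0 -k1; ring | rewrite addr0].
  by move/eqP; rewrite mulf_eq0 pnatr_eq0 => /eqP.
have a1 : a 1 = 0.
  move: k0; rewrite a0 add0r => /eqP; rewrite mulf_eq0 => /orP[/eqP//|].
  by rewrite eq_complex /= oner_eq0 andbF.
rewrite !dirE /= a0 a1 k4 k5 in k2 k3.
have [cc0 cc1] : c 0 = 0 /\ c 1 = 0.
  pose al := - 2 * c1%:C - 2 * c2%:C ^+ 2 * cg 0 p + 2 * c2%:C * 'i%C * cM 2 p.
  pose be := - 2 * c1%:C * 'i%C - 2 * c2%:C ^+ 2 * cg 1 p - 2 * c2%:C * cM 2 p.
  pose al' := - 2 * c1%:C - 2 * c2%:C ^+ 2 * cg 0 p - 2 * c2%:C * 'i%C * cM 2 p.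
  pose be' := 2 * c1%:C * 'i%C - 2 * c2%:C ^+ 2 * cg 1 p - 2 * c2%:C * cM 2 p.
  have E1 : c 0 * al + c 1 * be = 0 by rewrite -k2 /al /be; ring.
  have E2 : c 0 * al' + c 1 * be' = 0 by rewrite -k3 /al' /be'; ring.
  have det : al * be' - be * al' = - 8 * 'i%C * coord_minor p.
    by rewrite /al /be /al' /be' /coord_minor; ring: (sqr_i R).
  have det0 : - 8 * 'i%C * coord_minor p != 0.
    rewrite !mulf_neq0 ?oppr_eq0 ?pnatr_eq0//.
    by rewrite eq_complex /= oner_eq0 andbF.
  (* Cramer's rule. *)
  split; apply: (mulIf det0); rewrite mul0r -det.
    transitivity (be' * (c 0 * al + c 1 * be) - be * (c 0 * al' + c 1 * be')); first by ring.
    by rewrite E1 E2 !mulr0 subr0.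
  transitivity (al * (c 0 * al' + c 1 * be') - al' * (c 0 * al + c 1 * be)); first by ring.
  by rewrite E1 E2 !mulr0 subr0.
have ord3 (P : 'I_3 -> Prop) : P 0 -> P 1 -> P 2 -> forall k, P k.
  by move=> P0 P1 P2 [[|[|[|//]]] kP];
    [move: P0 | move: P1 | move: P2]; congr P; apply: val_inj.
apply/rowP => j; rewrite mxE -(splitK j); case: (fintype.split j) => k /=.
  by apply: (ord3 (fun k => v 0 (lshift 3 k) = 0)); [exact: a0 | exact: a1 | exact: k4].
by apply: (ord3 (fun k => v 0 (rshift 3 k) = 0)); [exact: cc0 | exact: cc1 | exact: k5].
Qed.

End SokolovGeneric.

Theorem proposition1 (R : realType) (c1 c2 : R) :
  exists (F : phase R -> triquadratic R[i]) (P J : phase R -> {poly R[i]})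
         (lambda c : R[i]),
  let V := sokolov_field c1 c2 in
  let z1 := @sokolov_z1 R in
  let z2 := @sokolov_z2 R in
  let e1 := sokolov_e1 c1 c2 in
  let e2 := sokolov_e2 c1 c2 in
  [/\ kowalevski_equations V z1 z2 e1 e2 F P J,
      abel_equations V z1 z2 e1 e2 F J lambda c &
      (c1 != 0) || (c2 != 0) ->
        generically (coordinates_at z1 z2 e1 e2 (Mc 2) (gc 2)) /\
        generically (fun p : phase R => forall k : R[i],
          k ^+ 2 = e1 p * e2 p -> genus_two (curve_poly lambda (J p) k))].
Proof.
exists (sokolov_F c1 c2), (sokolov_P c1 c2), (sokolov_J c1 c2), (- 4), 1; split.
- exact: sokolov_kowalevski.
- exact: sokolov_abel.
- by move=> c0; split; [exact: coordinates_generic | exact: genus_two_generic].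
Qed.
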